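(* Let $\Gamma$ be a non-elementary word-hyperbolic group, $(M,d)$ a proper geodesic metric space, and $\rho:\Gamma\to\mathrm{LHomeo}(M)$ an action which is meandering-hyperbolic at a non-empty compact invariant subset $\Lambda\subset M$, no point of which is isolated in $M$. Then there exists an equivariant continuous surjective map $\pi:\Lambda\to\partial_\infty\Gamma$ to the Gromov boundary of $\Gamma$, namely the postal map of $\rho$; moreover, for each minimal non-empty closed $\Gamma$-invariant subset $\Lambda_\mu\subset\Lambda$, the restriction $\pi|_{\Lambda_\mu}:\Lambda_\mu\to\partial_\infty\Gamma$ is quasi-open.
   Context: A map between topological spaces is quasi-open if the image of every non-empty open subset has non-empty interior. A hyperbolic group is non-elementary if it has no cyclic subgroup of finite index. Conventions: $\mathbb N_0=\{0,1,2,\dots\}$, $\mathbb N=\{1,2,\dots\}$; $B_r(x)$ is the open $r$-ball, $N_r(\Lambda)$ the open $r$-neighborhood. A metric space is proper if its closed balls are compact, geodesic if any two points are joined by an isometrically embedded interval. $\mathrm{LHomeo}(M)$ is the group of homeomorphisms of $M$ whose restrictions to compact subsets are bi-Lipschitz. Expansion. Let $f$ be a homeomorphism of $M$, $\lambda>1$, $U\subset M$, $\delta>0$. $f$ is $(\lambda,U)$-expanding if $d(f(x),f(y))\ge\lambda d(x,y)$ for all $x,y\in U$; it is $(\lambda,U;\delta)$-expanding if moreover $B_{\lambda\eta}(f(x))\subset f(B_\eta(x))$ whenever $B_\eta(x)\subset U$ and $\eta\le\delta$. For an open cover $\mathcal U$ of $\Lambda$, $\delta_{\mathcal U}$ is the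 supremum of its Lebesgue numbers (numbers $\delta>0$ such that for every $x\in\Lambda$ the ball $B_\delta(x)$ lies in a member of $\mathcal U$). An action $\rho$ with non-empty compact invariant subset $\Lambda$, no point of which is isolated in $M$, is expanding at $\Lambda$ if there are a finite index set $\mathcal I$, a cover $\mathcal U=\{U_i\mid i\in\mathcal I\}$ of $\Lambda$ by open (possibly empty) subsets of $M$, a map $\mathcal I\to\Gamma$, $i\mapsto s_i$, and real numbers $L\ge\lambda>1$ and $0<\delta\le\delta_{\mathcal U}$ such that for each $i$ the map $\rho(s_i^{-1})$ is $L$-Lipschitz on $N_\delta(\Lambda)$ and $(\lambda,U_i;\delta)$-expanding, and $\Sigma=\{s_i\mid i\in\mathcal I\}$ is a symmetric generating set of $\Gamma$. Then $\mathcal D=(\mathcal I,\mathcal U,\Sigma,\delta,L,\lambda)$ is an expansion datum of $\rho$; $d_\Sigma$ is the word metric on $\Gamma$. Codes and rays. Let $x\in\Lambda$, $0<\eta\le\delta$. For $\alpha:\mathbb N_0\to\mathcal I$ put $p_0=x$, $p_{k+1}=\rho(s_{\alpha(k)}^{-1})(p_k)$. $\alpha$ is a $(\mathcal D,\eta)$-code for $x$ if $B_\eta(p_k)\subset U_{\alpha(k)}$ for every $k\in\mathbb N$ (nothing is required for $k=0$). Its ray is $c^\alpha:\mathbb N_0\to\Gamma$, $c^\alpha_k=s_{\alpha(0)}s_{\alpha(1)}\cdots s_{\alpha(k)}$. $\mathrm{Ray}_x(\mathcal D,\eta)$ is the set of rays of all $(\mathcal D,\eta)$-codes for $x$. Refinement.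 For expansion data $\mathcal D_k=(\mathcal I_k,\mathcal U_k,\Sigma_k,\delta_k,L_k,\lambda_k)$, $k=0,1$, of $\rho$, write $\mathcal D_0\prec\mathcal D_1$ ($\mathcal D_1$ is a refinement of $\mathcal D_0$) if $\mathcal I_0\subset\mathcal I_1$, $U_{0,i}\subset U_{1,i}$ and $s_{0,i}=s_{1,i}$ for all $i\in\mathcal I_0$, $\delta_0>\delta_1$, $L_0\le L_1$, $\lambda_0\ge\lambda_1$. Equivalence. For $N\in\mathbb N_0$, write $c^\alpha\approx^N_{(\mathcal D,\eta)}c^\beta$ for $c^\alpha,c^\beta\in\mathrm{Ray}_x(\mathcal D,\eta)$ if there are infinite subsets $P,Q\subset\mathbb N_0$ such that $\{c^\alpha_k\mid k\in P\}$ and $\{c^\beta_j\mid j\in Q\}$ are within Hausdorff distance $N$ in $(\Gamma,d_\Sigma)$. $(\mathcal D,\eta;N)$-equivalence is the equivalence relation on $\mathrm{Ray}_x(\mathcal D,\eta)$ generated by $\approx^N_{(\mathcal D,\eta)}$. Meandering hyperbolicity. $\rho$ is meandering-hyperbolic at $\Lambda$, with datum $(\mathcal D_0\prec\mathcal D;N)$, if $\mathcal D_0$ is an expansion datum (with constant $\delta_0$), $\mathcal D\succ\mathcal D_0$ a refinement (with constant $\delta$) and $N\ge1$ an integer such that for every $x\in\Lambda$ all rays in $\mathrm{Ray}_x(\mathcal D_0,\delta_0)$ are $(\mathcal D,\delta;N)$-equivalent (as rays in $\mathrm{Ray}_x(\mathcal D,\delta)$). Postal map. All rays $c^\alpha$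 are quasigeodesic rays in $(\Gamma,d_\Sigma)$. For hyperbolic $\Gamma$ and $\rho$ meandering-hyperbolic with datum $(\mathcal D_0\prec\mathcal D;N)$, the postal map $\pi:\Lambda\to\partial_\infty\Gamma$ sends $x$ to the point of $\partial_\infty\Gamma$ represented by a ray $c^\alpha\in\mathrm{Ray}_x(\mathcal D_0,\delta_0)$; this is independent of the choice of the ray. *)

(* Defs.v *)
From HB Require Import structures.
From Stdlib Require Export Relations.Relation_Operators.
From mathcomp Require Export all_boot all_order all_algebra.
From mathcomp Require Export all_classical all_reals all_analysis.
Set Implicit Arguments.
Unset Strict Implicit.
Unset Printing Implicit Defensive.
Import Order.TTheory GRing.Theory Num.Theory.

Local Open Scope classical_set_scope.
Local Open Scope ring_scope.

Section WordMetric.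
Variable G : groupType.
Implicit Types (S : set G) (g x y : G) (c : nat -> G) (P : set nat).

Definition spelled S (n : nat) g : Prop :=
  exists w : seq G,
    [/\ size w = n, forall x, x \in w -> S x & g = (\prod_(x <- w) x)%g].

(* Since S is symmetric, monoid words in S suffice to express generation. *)
Definition symmetric_generating S : Prop :=
  (forall x, S x -> S x^-1%g) /\ (forall g, exists n, spelled S n g).

(* Only meaningful for generating S; elsewhere the junk value is 0. *)
Definition word_length S g : nat :=
  xget 0%N [set n | spelled S n g /\ forall m, spelled S m g -> (n <= m)%N].

Definition word_dist S x y : nat := word_length S (x^-1 * y)%g.

(* Gromov's four-point condition at every base point; [e] is twice the usual
   hyperbolicity constant. *)
Definition hyperbolic_group S : Prop :=
  [/\ finite_set S, symmetric_generating S &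
      exists e : nat, forall x y z w : G,
        (word_dist S x z + word_dist S y w <=
         maxn (word_dist S x y + word_dist S z w)
              (word_dist S y z + word_dist S x w) + e)%N].

Definition cyclic_subgroup g : set G :=
  [set x | exists n : nat, x = (g ^+ n)%g \/ x = (g ^- n)%g].

Definition finite_index (H : set G) : Prop :=
  exists2 T : set G, finite_set T &
    forall x, exists t h, [/\ T t, H h & x = (t * h)%g].

Definition non_elementary : Prop :=
  ~ exists g, finite_index (cyclic_subgroup g).

(* The word metric is integer-valued, so the infima in the Hausdorff distance
   are attained. *)
Definition hausdorff_within S (n : nat) (A B : set G) : Prop :=
  (forall a, A a -> exists2 b, B b & (word_dist S a b <= n)%N) /\
  (forall b, B b -> exists2 a, A a & (word_dist S a b <= n)%N).

(* |i - j|/A - C <= d(c i, c j) <= A|i - j| + C without division; enlarging the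
   constants makes them integers, and A * C absorbs into C. *)
Definition quasigeodesic_ray S c : Prop :=
  exists A C : nat, forall i j : nat, (i <= j)%N ->
    (j - i <= A * word_dist S (c i) (c j) + C)%N /\
    (word_dist S (c i) (c j) <= A * (j - i) + C)%N.

Definition asymptotic S c c' : Prop :=
  exists n : nat, hausdorff_within S n (range c) (range c').

(* Twice the Gromov product based at 1; the truncated subtraction is exact by
   the triangle inequality. *)
Definition gromov_prod2 S x y : nat :=
  (word_length S x + word_length S y - word_dist S x y)%N.

Definition ray_class S c : set (nat -> G) :=
  [set c' | quasigeodesic_ray S c' /\ asymptotic S c c'].

End WordMetric.

(* Points of the boundary are asymptote classes of quasigeodesic rays. *)
Record gromov_boundary (G : groupType) (S : set G) := GromovBoundary {
  boundary_class : set (nat -> G);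
  boundary_classP : exists2 c, quasigeodesic_ray S c &
                      boundary_class = ray_class S c }.

Section Boundary.
Variables (G : groupType) (S : set G).
Local Notation bd := (gromov_boundary S).
Implicit Types (xi zeta : bd) (c : nat -> G) (g x y : G).

HB.instance Definition _ := gen_eqMixin bd.
HB.instance Definition _ := gen_choiceMixin bd.

Definition represents c xi : Prop := boundary_class xi c.

(* zeta belongs to the r-th basic neighbourhood of xi when some representatives
   satisfy liminf_(i, j) 2(c i|c' j) >= r; the product is integer-valued, so the
   liminf condition says that the inequality holds eventually. *)
Definition boundary_shadow xi (r : nat) : set bd :=
  [set zeta | exists c c', [/\ represents c xi, represents c' zeta &
    exists n : nat, forall i j : nat, (n <= i)%N -> (n <= j)%N ->
      (r <= gromov_prod2 S (c i) (c' j))%N]].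

Definition boundary_open (W : set bd) : Prop :=
  forall xi, W xi -> exists r, boundary_shadow xi r `<=` W.

Lemma boundary_shadow_le xi r s :
  (r <= s)%N -> boundary_shadow xi s `<=` boundary_shadow xi r.
Proof.
move=> rs z [c [c' [cx cz [n Hn]]]]; exists c, c'; split=> //.
by exists n => i j ni nj; apply: leq_trans rs (Hn i j ni nj).
Qed.

Lemma boundary_openT : boundary_open setT.
Proof. by move=> xi _; exists 0%N. Qed.

Lemma boundary_openI : setI_closed boundary_open.
Proof.
move=> V W oV oW xi [/oV[r rV] /oW[s sW]]; exists (maxn r s) => z Hz; split.
  by apply: rV; apply: boundary_shadow_le Hz; apply: leq_maxl.
by apply: sW; apply: boundary_shadow_le Hz; apply: leq_maxr.
Qed.

Lemma boundary_open_bigU (I : Type) (f : I -> set bd) :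
  (forall i, boundary_open (f i)) -> boundary_open (\bigcup_i f i).
Proof.
move=> of_ xi [i _ /of_[r rf]]; exists r => z /rf fz; by exists i.
Qed.

HB.instance Definition _ :=
  isOpenTopological.Build bd boundary_openT boundary_openI boundary_open_bigU.

Definition translate g c : nat -> G := fun k => (g * c k)%g.

Lemma word_dist_translate g x y :
  word_dist S (g * x)%g (g * y)%g = word_dist S x y.
Proof. by rewrite /word_dist invgM -mulgA mulKg. Qed.

Lemma hausdorff_within_translate g n (c c' : nat -> G) :
  hausdorff_within S n (range c) (range c') ->
  hausdorff_within S n (range (translate g c)) (range (translate g c')).
Proof.
case=> H1 H2; split=> _ [i _ <-].
  have [|_ [j _ <-] le_n] := H1 (c i); first by exists i.
  by exists (translate g c' j); [exists j | rewrite word_dist_translate].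
have [|_ [j _ <-] le_n] := H2 (c' i); first by exists i.
by exists (translate g c j); [exists j | rewrite word_dist_translate].
Qed.

Lemma quasigeodesic_translate g c :
  quasigeodesic_ray S c -> quasigeodesic_ray S (translate g c).
Proof.
by case=> A [C H]; exists A, C => i j ij; rewrite word_dist_translate; apply: H.
Qed.

Lemma translateK g c : translate g^-1%g (translate g c) = c.
Proof. by apply/funext => k; rewrite /translate mulKg. Qed.

Lemma boundary_act_subproof g xi :
  exists2 c, quasigeodesic_ray S c &
    translate g @` boundary_class xi = ray_class S c.
Proof.
case: (boundary_classP xi) => c qc ->.
exists (translate g c); first exact: quasigeodesic_translate.
apply/seteqP; split=> [_ [c' [qc' [n cc']] <-]|c' [qc' [n cc']]].
  split; first exact: quasigeodesic_translate.
  by exists n; apply: hausdorff_within_translate.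
exists (translate g^-1%g c').
  split; first exact: quasigeodesic_translate.
  by exists n; rewrite -(translateK g c); apply: hausdorff_within_translate.
by rewrite -{1}(invgK g) translateK.
Qed.

Definition boundary_act g xi : bd := GromovBoundary (boundary_act_subproof g xi).

End Boundary.

Section MetricSpaces.
Variables (R : realType) (M : metricType R).
Implicit Types (f : M -> M) (A U K : set M) (x y : M).

Definition proper_space : Prop :=
  forall x (r : R), compact [set y | mdist x y <= r].

Definition geodesic_space : Prop :=
  forall x y, exists gam : R -> M,
    [/\ gam 0 = x, gam (mdist x y) = y &
        forall s t, 0 <= s <= mdist x y -> 0 <= t <= mdist x y ->
          mdist (gam s) (gam t) = `|s - t|].

Definition homeomorphism f : Prop :=
  exists f', [/\ cancel f f', cancel f' f, continuous f & continuous f'].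

Definition lipschitz_within (L : R) A f : Prop :=
  forall x y, A x -> A y -> mdist (f x) (f y) <= L * mdist x y.

Definition bilipschitz_within (L : R) A f : Prop :=
  forall x y, A x -> A y ->
    L^-1 * mdist x y <= mdist (f x) (f y) <= L * mdist x y.

Definition LHomeo f : Prop :=
  homeomorphism f /\
  forall K, compact K -> exists2 L : R, 1 <= L & bilipschitz_within L K f.

Definition neighborhood (r : R) A : set M := \bigcup_(x in A) ball x r.

Definition expanding_on (lam : R) U f : Prop :=
  forall x y, U x -> U y -> lam * mdist x y <= mdist (f x) (f y).

Definition expanding_on_upto (lam : R) U (delta : R) f : Prop :=
  expanding_on lam U f /\
  forall x (eta : R), 0 < eta -> eta <= delta -> ball x eta `<=` U ->
    ball (f x) (lam * eta) `<=` f @` ball x eta.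

Definition lebesgue_number (I : Type) (Lam : set M) (U : I -> set M) (e : R) :
    Prop :=
  0 < e /\ forall x, Lam x -> exists i, ball x e `<=` U i.

(* Possibly +oo. *)
Definition sup_lebesgue (I : Type) (Lam : set M) (U : I -> set M) : \bar R :=
  ereal_sup [set e%:E | e in lebesgue_number Lam U].

End MetricSpaces.

Record datum (R : realType) (G : groupType) (M : Type) := Datum {
  idx : finType;
  cov : idx -> set M;  (* U_i *)
  gen : idx -> G;      (* s_i *)
  dlt : R;             (* delta *)
  lip : R;             (* L *)
  xpn : R              (* lambda *) }.

Section Actions.
Variables (R : realType) (G : groupType) (M : metricType R).
Variables (rho : G -> M -> M) (Lam : set M).
Implicit Types (D : datum R G M) (x : M) (c : nat -> G).

Definition LHomeo_action : Prop :=
  [/\ forall g, LHomeo (rho g), forall x, rho 1%g x = x &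
      forall g h x, rho (g * h)%g x = rho g (rho h x)].

Definition invariant_set (A : set M) : Prop := forall g x, A x -> A (rho g x).

Definition minimal_set (A : set M) : Prop :=
  [/\ A !=set0, closed A, invariant_set A &
      forall B : set M, B !=set0 -> closed B -> invariant_set B ->
        B `<=` A -> B = A].

Definition expansion_datum D : Prop :=
  [/\ (forall i, open (cov (d := D) i)) /\ Lam `<=` \bigcup_i cov (d := D) i,
      1 < xpn D <= lip D,
      0 < dlt D /\ ((dlt D)%:E <= sup_lebesgue Lam (cov (d := D)))%E,
      forall i, lipschitz_within (lip D) (neighborhood (dlt D) Lam)
                  (rho (gen i)^-1%g) /\
                expanding_on_upto (xpn D) (cov (d := D) i) (dlt D)
                  (rho (gen i)^-1%g) &
      symmetric_generating (range (gen (d := D)))].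

Fixpoint code_orbit D x (alpha : nat -> idx D) (k : nat) : M :=
  if k is k'.+1 then
    rho (gen (alpha k'))^-1%g (code_orbit x alpha k')
  else x.

(* The index k = 0 is deliberately exempt. *)
Definition is_code D (eta : R) x (alpha : nat -> idx D) : Prop :=
  forall k : nat, (0 < k)%N ->
    ball (code_orbit x alpha k) eta `<=` cov (alpha k).

Definition code_ray D (alpha : nat -> idx D) : nat -> G :=
  fun k => (\prod_(i < k.+1) gen (alpha i))%g.

Definition Ray D (eta : R) x : set (nat -> G) :=
  [set c | exists2 alpha, is_code (D := D) eta x alpha & c = code_ray alpha].

(* Index inclusions are rendered as injections. *)
Definition refines D0 D1 : Prop :=
  [/\ exists phi : idx D0 -> idx D1, injective phi /\
        forall i, cov i `<=` cov (phi i) /\ gen (phi i) = gen i,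
      dlt D1 < dlt D0, lip D0 <= lip D1 & xpn D1 <= xpn D0].

Definition ray_close D (eta : R) (N : nat) x c c' : Prop :=
  [/\ Ray D eta x c, Ray D eta x c' &
      exists P Q : set nat, [/\ infinite_set P, infinite_set Q &
        hausdorff_within (range (gen (d := D))) N (c @` P) (c' @` Q)]].

Definition ray_equiv D (eta : R) (N : nat) x : (nat -> G) -> (nat -> G) -> Prop :=
  clos_refl_sym_trans (nat -> G) (ray_close D eta N x).

Definition meandering_hyperbolic D0 D (N : nat) : Prop :=
  [/\ expansion_datum D0, expansion_datum D, refines D0 D, (1 <= N)%N &
      forall x, Lam x -> forall c c',
        Ray D0 (dlt D0) x c -> Ray D0 (dlt D0) x c' ->
        ray_equiv D (dlt D) N x c c'].

(* Every ray of a D0-code of x represents pi x; as such rays exist, this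
   determines pi. *)
Definition is_postal_map (S : set G) D0 (pi : Lam -> gromov_boundary S) : Prop :=
  forall x : Lam,
    Ray D0 (dlt D0) (set_val x) !=set0 /\
    (forall c, Ray D0 (dlt D0) (set_val x) c -> represents c (pi x)).

Definition equivariant (S : set G) (pi : Lam -> gromov_boundary S) : Prop :=
  forall g (x y : Lam), set_val y = rho g (set_val x) ->
    pi y = boundary_act g (pi x).

End Actions.

Definition quasi_open (T U : topologicalType) (f : T -> U) : Prop :=
  forall W : set T, open W -> W !=set0 -> (f @` W)° !=set0.

Definition set_incl (T : Type) (A B : set T) (AB : A `<=` B) (x : A) : B :=
  SigSub (mem_set (AB (set_val x) (set_valP x))).

(* Main.v *)
(* The product g of the k generators read off a code of x inverts to a map that
   expands by lambda^k near x, while a word of length n spelling g is at best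
   L^n-Lipschitz there; comparing at a nearby point, which exists because x is not
   isolated, gives k = O(n), so that rays are uniform quasigeodesics. By stability
   of quasigeodesics, rays that are close infinitely often are asymptotic, hence
   the postal map is well defined by meandering hyperbolicity. It is equivariant
   since a generator may be prepended to a code, and continuous since a code of x
   serves nearby points for a long time.
   The image of a compact invariant set is closed and invariant. If it had a single
   point, the Busemann function at this fixed point would be a quasimorphism with
   finite sublevel sets and the group would be elementary; so it has two points,
   whose orbits accumulate everywhere, and the image is the whole boundary.
   Finally, finitely many translates of a small compact K cover a minimal set, so
   the boundary is a finite union of translates of the closed image of K, which
   must therefore have interior points. *)
Require Import Defs.
From mathcomp Require Import zify lra.
Set Implicit Arguments.
Unset Strict Implicit.
Unset Printing Implicit Defensive.
Import Order.TTheory GRing.Theory Num.Theory.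
Local Open Scope classical_set_scope.

(** * Stability of quasigeodesics in hyperbolic metrics *)

(** Ends the bootstrap in [geodesic_near_path], where the exponent k is bounded by the logarithm of
    an expression linear in k itself. *)
Lemma expn2_le_linear (a b : nat) :
  exists k0, forall k, 2 ^ k <= a * k + b -> k <= k0.
Proof.
exists (4 * a + 4 * b)%N => k le_k.
have sq m : m.+1 * m.+1 <= 4 * 2 ^ m.
  elim: m => [//|[|[|m]] IH] //.
  by rewrite expnS; move: IH; set u := (2 ^ m.+2)%N; nia.
have := sq k; case: k le_k => [//|k] le_k; nia.
Qed.

Section HyperbolicMetric.
Variables (T : Type) (d : T -> T -> nat) (e : nat).
Hypothesis dxx : forall x, d x x = 0.
Hypothesis dC : forall x y, d x y = d y x.
Hypothesis dT : forall x y z, d x z <= d x y + d y z.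
Hypothesis d4 : forall x y z w,
  d x z + d y w <= maxn (d x y + d z w) (d y z + d x w) + e.
Hypothesis d_geodesic : forall x y, exists gam : nat -> T,
  [/\ gam 0 = x, gam (d x y) = y &
      forall s t, s <= t -> t <= d x y -> d (gam s) (gam t) = t - s].

Implicit Types c : nat -> T.

(** [quasigeodesic_ray] with its constants exposed, so that bounds uniform in c can be stated. *)
Definition quasigeodesic (A C : nat) c := forall i j, i <= j ->
  j - i <= A * d (c i) (c j) + C /\ d (c i) (c j) <= A * (j - i) + C.

Lemma quasigeodesic_step A C c k : quasigeodesic A C c ->
  d (c k) (c k.+1) <= A + C.
Proof. by move=> /(_ k k.+1 (leqnSn k)) []; rewrite subSnn muln1. Qed.

(* Repeated bisection: a path of 2^k steps staying D-far from w has endpoints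
   whose doubled Gromov product at w is at least 2D - O(k). *)
Lemma far_path_product c (B D : nat) w k i j :
  (forall k, d (c k) (c k.+1) <= B) -> i <= j -> j <= i + 2 ^ k ->
  (forall l, i <= l -> l <= j -> D <= d w (c l)) ->
  d (c i) (c j) + 2 * D <= d w (c i) + d w (c j) + B + e * k.
Proof.
move=> step; elim: k i j => [|k IH] i j ij jk far.
  have := far i (leqnn i) ij; have := far j ij (leqnn j).
  have [ji|ji] : j = i \/ j = i.+1 by lia.
    by rewrite ji dxx; lia.
  by have := step i; rewrite ji; lia.
pose m := minn j (i + 2 ^ k).
have im : i <= m by rewrite /m; lia.
have mj : m <= j by rewrite /m; lia.
have h1 := IH i m im.
have {}h1 : d (c i) (c m) + 2 * D <= d w (c i) + d w (c m) + B + e * k.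
  by apply: h1 => [|l il lm]; [rewrite /m; lia | apply: far; lia].
have h2 : d (c m) (c j) + 2 * D <= d w (c m) + d w (c j) + B + e * k.
  apply: IH => // [|l ml lj]; last by apply: far; lia.
  by move: jk; rewrite expnS /m; lia.
have := d4 (c i) (c m) (c j) w; rewrite (dC (c j) w) (dC (c m) w) (dC (c i) w).
have := far m im mj; rewrite mulnS; lia.
Qed.

(** Half of the Morse lemma. Let [gam t] be farthest from the path, at distance D. Points 2D before
    and after it are near the path, and the stretch of path joining them has O(D) steps while
    avoiding the open D-ball around [gam t]; [far_path_product] then gives 2D = O(log D). *)
Lemma geodesic_near_path A C : exists D0, forall c, quasigeodesic A C c ->
  forall i j, i <= j -> forall gam : nat -> T,
  gam 0 = c i -> gam (d (c i) (c j)) = c j ->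
  (forall s t, s <= t -> t <= d (c i) (c j) -> d (gam s) (gam t) = t - s) ->
  forall t, t <= d (c i) (c j) ->
  exists k, [/\ i <= k, k <= j & d (gam t) (c k) <= D0].
Proof.
(* The coefficients come from [2 ^ k <= 2 * q + 1] with [q = 6 * A * D + C], after D is replaced by
   its bound linear in k. *)
have [k0 k0P] := expn2_le_linear (12 * A * e) (12 * A * (2 * e + (A + C)) + 2 * C + 1).
exists (2 * e + (A + C) + e * k0) => c qc i j ij gam g0 g1 gd.
pose l := d (c i) (c j); rewrite -/l in g1 gd *.
pose far D t := forall k, i <= k -> k <= j -> D <= d (gam t) (c k).
pose P D := `[< exists2 t, t <= l & far D t >].
have exP : exists D, P D by exists 0; apply/asboolP; exists 0.
have bP D : P D -> D <= l.
  move=> /asboolP[t tl /(_ i (leqnn i) ij)].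
  by rewrite -g0 dC gd //; lia.
case: (ex_maxnP exP bP) => D /asboolP[t tl fart] maxD.
have near s : s <= l -> exists k, [/\ i <= k, k <= j & d (gam s) (c k) <= D].
  move=> sl; apply: contrapT => no.
  suff /maxD : P D.+1 by lia.
  apply/asboolP; exists s => // k ik kj; rewrite ltnNge; apply/negP => le.
  by apply: no; exists k.
suff leD : D <= 2 * e + (A + C) + e * k0.
  by move=> s /near [k [ik kj le]]; exists k; split=> //; apply: leq_trans le leD.
have [s1 s1E] : exists s, s = t - 2 * D by exists (t - 2 * D).
have [s2 s2E] : exists s, s = minn l (t + 2 * D) by exists (minn l (t + 2 * D)).
(* [far1] says that the doubled Gromov product of [gam s1] and [c k1] at [gam t] is at least 2D. If
   truncation cuts [s1] off at 0, the endpoint [c i] serves. *)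
have [k1 [ik1 k1j dk1 far1]] : exists k1, [/\ i <= k1, k1 <= j,
    d (gam s1) (c k1) <= D &
    2 * D + d (gam s1) (c k1) <= d (gam t) (gam s1) + d (gam t) (c k1)].
  case: (leqP (2 * D) t) => h.
    have [|k [ik kj le]] := near s1; first by lia.
    exists k; split=> //; have := fart k ik kj.
    by rewrite (dC (gam t) (gam s1)) gd; lia.
  exists i; have -> : s1 = 0 by lia.
  by rewrite g0 dxx; have := fart i (leqnn i) ij; split=> //; lia.
have [k2 [ik2 k2j dk2 far2]] : exists k2, [/\ i <= k2, k2 <= j,
    d (gam s2) (c k2) <= D &
    2 * D + d (gam s2) (c k2) <= d (gam t) (gam s2) + d (gam t) (c k2)].
  case: (leqP (t + 2 * D) l) => h.
    have [|k [ik kj le]] := near s2; first by lia.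
    exists k; split=> //; have := fart k ik kj.
    by rewrite gd; lia.
  exists j; have -> : s2 = l by lia.
  by rewrite g1 dxx; have := fart j ij (leqnn j); split=> //; lia.
have seg : d (gam t) (gam s1) + d (gam t) (gam s2) = d (gam s1) (gam s2).
  by rewrite (dC (gam t) (gam s1)) !gd; lia.
have len : d (gam s1) (gam s2) <= 4 * D by rewrite gd; lia.
case: (leqP D e) => De; first by lia.
(* the product of c k1 and c k2 at gam t is bounded because that of gam s1 and
   gam s2 vanishes *)
have mid : d (gam t) (c k1) + d (gam t) (c k2) <= d (c k1) (c k2) + 2 * e.
  have := d4 (gam s1) (c k1) (gam s2) (gam t).
  have := d4 (c k1) (c k2) (gam s2) (gam t).
  rewrite (dC (gam s1) (gam t)) (dC (gam s2) (gam t)) (dC (c k1) (gam t)).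
  rewrite (dC (c k2) (gam t)) (dC (c k2) (gam s2)); lia.
have dkk : d (c k1) (c k2) <= 6 * D.
  have := dT (c k1) (gam s1) (c k2); have := dT (gam s1) (gam s2) (c k2).
  by rewrite (dC (c k1) (gam s1)); lia.
pose a := minn k1 k2; pose b := maxn k1 k2.
have ab : a <= b by rewrite /a /b; lia.
have [sab1 sab2] : d (c a) (c b) = d (c k1) (c k2) /\
    d (gam t) (c a) + d (gam t) (c b) = d (gam t) (c k1) + d (gam t) (c k2).
  rewrite /a /b; case: (leqP k1 k2) => h; first by [].
  by rewrite (dC (c k2)) addnC.
pose q := 6 * A * D + C.
have lenab : b - a <= q.
  have [lenab _] := qc a b ab; apply: leq_trans lenab _.
  by rewrite sab1 /q; nia.
pose k := up_log 2 q.
have qk : q <= 2 ^ k by apply: up_logP.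
have qk' : 2 ^ k <= 2 * q + 1.
  have [q1|q1] := leqP q 1.
    have /eqP -> : k == 0 by rewrite /k up_log_eq0 q1 orbT.
    by rewrite expn0 addn1.
  have := up_log_gtn (leqnn 2) q1; rewrite -/k.
  by case: (k) => [|m] /=; rewrite ?expnS; lia.
have := @far_path_product c (A + C) D (gam t) k a b
  (fun m => quasigeodesic_step m qc) ab.
rewrite sab1 => /(_ _ _) far12.
have {far12} leD : 2 * D <= 2 * e + (A + C) + e * k.
  have : d (c k1) (c k2) + 2 * D <=
      d (gam t) (c a) + d (gam t) (c b) + (A + C) + e * k.
    by apply: far12 => [|l0 al lb]; [lia | apply: fart; rewrite /a /b in al lb; lia].
  by rewrite sab2; lia.
have kk0 : k <= k0.
  apply: k0P; apply: leq_trans qk' _; rewrite /q.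
  have : A * D <= A * (2 * e + (A + C) + e * k) by
    rewrite leq_mul2l; apply/orP; right; lia.
  by nia.
have : e * k <= e * k0 by rewrite leq_mul2l kk0 orbT.
by lia.
Qed.

(** The last point of the geodesic that is near the path before time n is followed by one near the
    path after time n. So [c n] lies between two path points that are close in space, hence in time,
    and is within E of the geodesic; the triangle defect is at most 2E. *)
Lemma quasigeodesic_products A C : exists H, forall c, quasigeodesic A C c ->
  forall i n j, i <= n -> n <= j ->
  d (c i) (c n) + d (c n) (c j) <= d (c i) (c j) + H.
Proof.
have [D0 D0P] := geodesic_near_path A C.
pose m := A * (2 * D0 + 1) + C; pose E := D0 + (A * m + C).
exists (2 * E) => c qc i n j iln nj.
have ij : i <= j by lia.
have [gam [g0 g1 gd]] := d_geodesic (c i) (c j).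
have near := D0P c qc i j ij gam g0 g1 gd.
have short a b : a <= b -> d (c a) (c b) <= 2 * D0 + 1 -> b - a <= m.
  move=> ab le; have [h _] := qc a b ab; apply: leq_trans h _.
  by rewrite /m leq_add2r leq_mul2l le orbT.
have close a b t : a <= n -> n <= b -> d (c a) (c b) <= 2 * D0 + 1 ->
    t <= d (c i) (c j) -> d (gam t) (c a) <= D0 ->
    d (c i) (c n) + d (c n) (c j) <= d (c i) (c j) + 2 * E.
  move=> an nb le tl ta.
  have nam : n - a <= m by have := short a b (leq_trans an nb) le; lia.
  have [_ h] := qc a n an.
  have {}h : d (c a) (c n) <= A * m + C.
    by apply: leq_trans h _; rewrite leq_add2r leq_mul2l nam orbT.
  have := dT (c i) (gam t) (c n); have := dT (gam t) (c a) (c n).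
  have := dT (c n) (gam t) (c j); rewrite (dC (c n) (gam t)).
  have -> : d (c i) (gam t) = t by rewrite -{1}g0 gd // subn0.
  have -> : d (gam t) (c j) = d (c i) (c j) - t by rewrite -{1}g1 gd.
  by rewrite /E; lia.
pose P t := `[< t <= d (c i) (c j) /\
  exists k, [/\ i <= k, k <= n & d (gam t) (c k) <= D0] >].
have exP : exists t, P t.
  by exists 0; apply/asboolP; split=> //; exists i; rewrite g0 dxx.
have bP t : P t -> t <= d (c i) (c j) by move/asboolP => [].
case: (ex_maxnP exP bP) => t /asboolP[tl [a [ia an ta]]] tmax.
case: (ltnP t (d (c i) (c j))) => h.
  have [b [ib bj tb]] := near t.+1 h.
  have nb : n <= b.
    rewrite leqNgt; apply/negP => bn.
    suff /tmax : P t.+1 by lia.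
    by apply/asboolP; split=> //; exists b; split=> //; lia.
  apply: (close a b t) => //.
  have := dT (c a) (gam t) (c b); have := dT (gam t) (gam t.+1) (c b).
  by rewrite (dC (c a) (gam t)) gd //; lia.
(* No point follows the end of the geodesic, but there j itself is a time past n. *)
apply: (close a j t) => //.
have tE : t = d (c i) (c j) by lia.
by rewrite tE g1 dC in ta; lia.
Qed.

End HyperbolicMetric.

(** * Word metrics *)

Section WordMetric.
Variables (G : groupType) (S : set G).
Hypothesis genS : symmetric_generating S.

Lemma spelledM m n (g h : G) :
  spelled S m g -> spelled S n h -> spelled S (m + n) (g * h)%g.
Proof.
move=> [v [<- vS ->]] [w [<- wS ->]]; exists (v ++ w).
rewrite size_cat big_cat; split=> // x.
by rewrite mem_cat => /orP[/vS|/wS].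
Qed.

Lemma spelledV n (g : G) : spelled S n g -> spelled S n g^-1%g.
Proof.
case: genS => SV _ [w [<- wS ->]] {n g}; elim: w wS => [|x w IH] wS.
  by rewrite big_nil invg1; exists [::]; rewrite big_nil; split.
rewrite big_cons invgM /= -addn1; apply: spelledM.
  by apply: IH => y yw; apply: wS; rewrite inE yw orbT.
exists [:: x^-1%g]; rewrite big_seq1; split=> // y; rewrite inE => /eqP ->.
by apply: SV; apply: wS; rewrite inE eqxx.
Qed.

Lemma word_lengthP (g : G) : spelled S (word_length S g) g /\
  forall m, spelled S m g -> word_length S g <= m.
Proof.
rewrite /word_length; case: xgetP => [n -> //|no].
have ex : exists n, `[< spelled S n g >].
  by case: genS => _ /(_ g)[n gn]; exists n; apply/asboolP.
case: (ex_minnP ex) => n /asboolP gn le.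
by case: (no n); split=> // m gm; apply: le; apply/asboolP.
Qed.

Lemma word_length_le m (g : G) : spelled S m g -> word_length S g <= m.
Proof. by case: (word_lengthP g) => _; apply. Qed.

Lemma word_length1 : word_length S 1%g = 0.
Proof.
apply/eqP; rewrite -leqn0; apply: word_length_le.
by exists [::]; rewrite big_nil; split.
Qed.

Lemma word_lengthV (g : G) : word_length S g^-1%g = word_length S g.
Proof.
have le (h : G) : word_length S h^-1%g <= word_length S h.
  by apply/word_length_le/spelledV; case: (word_lengthP h).
by apply/eqP; rewrite eqn_leq le -{1}(invgK g) le.
Qed.

Lemma word_lengthM (g h : G) :
  word_length S (g * h)%g <= word_length S g + word_length S h.
Proof.
by apply: word_length_le;
  apply: spelledM; [case: (word_lengthP g)|case: (word_lengthP h)].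
Qed.

Lemma word_distxx (x : G) : word_dist S x x = 0.
Proof. by rewrite /word_dist mulVg word_length1. Qed.

Lemma word_distC (x y : G) : word_dist S x y = word_dist S y x.
Proof. by rewrite /word_dist -word_lengthV invgM invgK. Qed.

Lemma word_distT (x y z : G) :
  word_dist S x z <= word_dist S x y + word_dist S y z.
Proof.
apply: leq_trans (word_lengthM _ _).
by rewrite mulgA mulgK.
Qed.

Lemma word_dist1 (x : G) : word_dist S 1%g x = word_length S x.
Proof. by rewrite /word_dist invg1 mul1g. Qed.

(** Prefixes of a shortest word trace a geodesic: the upper bounds on three consecutive segments add
    up to the exact distance, so none of them is strict. *)
Lemma word_dist_geodesic (x y : G) : exists gam : nat -> G,
  [/\ gam 0 = x, gam (word_dist S x y) = y &
      forall s t, s <= t -> t <= word_dist S x y ->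
        word_dist S (gam s) (gam t) = t - s].
Proof.
have [[w [sw wS xyE]] min] := word_lengthP (x^-1 * y)%g.
rewrite -/(word_dist S x y) in sw min.
pose gam k := (x * \prod_(a <- take k w) a)%g.
have g0 : gam 0 = x by rewrite /gam take0 big_nil mulg1.
have g1 : gam (word_dist S x y) = y.
  by rewrite /gam -sw take_size -xyE mulgA mulgV mul1g.
have le s t : s <= t -> word_dist S (gam s) (gam t) <= t - s.
  move=> st; rewrite /gam word_dist_translate.
  rewrite -(subnKC st) takeD big_cat.
  rewrite -[X in word_dist S X _]mulg1 word_dist_translate word_dist1.
  apply: (@leq_trans (size (take (t - s) (drop s w)))); last first.
    by rewrite size_take_min; lia.
  apply: word_length_le; exists (take (t - s) (drop s w)); split=> // a.
  by move=> /mem_take /mem_drop; exact: wS.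
exists gam; split=> // s t st tl.
have h1 := le 0 s (leq0n _); have h2 := le _ _ st; have h3 := le _ _ tl.
have := word_distT (gam 0) (gam s) (gam (word_dist S x y)).
have := word_distT (gam s) (gam t) (gam (word_dist S x y)).
rewrite g0 g1 in h1 h3 *; lia.
Qed.

Lemma finite_word_ball n : finite_set S ->
  finite_set [set g : G | word_length S g <= n].
Proof.
move=> finS; elim: n => [|n IH].
  apply: (@sub_finite_set _ _ [set 1%g]); last exact: finite_set1.
  move=> g /=; rewrite leqn0 => /eqP g0.
  have [[w [sw _ ->]] _] := word_lengthP g.
  by rewrite g0 in sw; rewrite (size0nil sw) big_nil.
pose B := [set g | word_length S g <= n].
apply: (@sub_finite_set _ _ ([set (x * y)%g | x in S & y in B] `|` B)); last first.
  by rewrite finite_setU; split=> //; apply: finite_image2.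
move=> g /=; rewrite leq_eqVlt ltnS => /orP[/eqP gn|gn]; last by right.
left; have [[w [sw wS gE]] _] := word_lengthP g.
rewrite gn in sw; case: w sw wS gE => [//|x w] /= [sw] wS.
rewrite big_cons => ->; exists x; first by apply: wS; rewrite inE eqxx.
exists (\prod_(a <- w) a)%g => //=.
by apply: word_length_le; exists w; split=> // a aw; apply: wS; rewrite inE aw orbT.
Qed.

End WordMetric.

(** Transfers estimates between the generators of an expansion datum and [S], in which the boundary
    is formulated. *)
Lemma word_length_change (G : groupType) (S S' : set G) : finite_set S ->
  symmetric_generating S -> symmetric_generating S' ->
  exists K, forall g, word_length S' g <= K * word_length S g.
Proof.
move=> finS genS genS'.
have [K leK] : exists K, forall x, S x -> word_length S' x <= K.
  have [X SE] : exists X : seq G, S = [set` X] by apply/finite_seqP.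
  exists (\max_(x <- X) word_length S' x) => x; rewrite SE /= => xX.
  exact: (@leq_bigmax_seq _ X xpredT (word_length S') x).
exists K => g; have [[w [<- wS ->]] _] := word_lengthP genS g.
elim: w wS => [|x w IH] wS; first by rewrite big_nil word_length1 // muln0.
rewrite big_cons /= mulnS; apply: leq_trans (word_lengthM _ _ _) _ => //.
apply: leq_add; first by apply: leK; apply: wS; rewrite inE eqxx.
by apply: IH => y yw; apply: wS; rewrite inE yw orbT.
Qed.

(** * Quasigeodesic rays in hyperbolic groups *)

Lemma asymptotic_refl (G : groupType) (S : set G) c :
  symmetric_generating S -> asymptotic S c c.
Proof. by move=> genS; exists 0; split=> x cx; exists x; rewrite // word_distxx. Qed.

Lemma asymptotic_sym (G : groupType) (S : set G) c c' :
  symmetric_generating S -> asymptotic S c c' -> asymptotic S c' c.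
Proof.
move=> genS [n [h1 h2]]; exists n; split=> x.
  by move=> /h2[y cy xy]; exists y; rewrite // word_distC.
by move=> /h1[y cy xy]; exists y; rewrite // word_distC.
Qed.

Lemma asymptotic_trans (G : groupType) (S : set G) c1 c2 c3 :
  symmetric_generating S ->
  asymptotic S c1 c2 -> asymptotic S c2 c3 -> asymptotic S c1 c3.
Proof.
move=> genS [m [h1 h2]] [n [k1 k2]]; exists (m + n); split.
  move=> x /h1[y /k1[z cz yz] xy]; exists z => //.
  by apply: leq_trans (word_distT genS x y z) _; lia.
move=> z /k2[y /h2[x cx xy] yz]; exists x => //.
by apply: leq_trans (word_distT genS x y z) _; lia.
Qed.

(** * Gromov products along quasigeodesic rays *)

Section GromovProducts.
Variables (G : groupType) (S : set G).
Hypothesis hypS : hyperbolic_group S.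

Local Notation d := (word_dist S).
Local Notation len := (word_length S).
Local Notation gp := (gromov_prod2 S).
Implicit Types (c : nat -> G) (x y z : G).

Let genS : symmetric_generating S. Proof. by case: hypS. Qed.

(** Removes the truncated subtraction, so that linear arithmetic applies. *)
Lemma gromov_prod2E x y : gp x y + d x y = len x + len y.
Proof.
rewrite /gromov_prod2 subnK // -!(word_dist1 S) (word_distC genS 1%g x).
exact: word_distT.
Qed.

Lemma gromov_prod2C x y : gp x y = gp y x.
Proof. by rewrite /gromov_prod2 word_distC // addnC. Qed.

Lemma word_length_dist x y : len y <= len x + d x y.
Proof. by rewrite -!(word_dist1 S); apply: word_distT. Qed.

Lemma gromov_prod2_le x y : gp x y <= 2 * len x.
Proof. by have := word_length_dist x y; have := gromov_prod2E x y; lia. Qed.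

Lemma gromov_prod2_hyp : exists e, forall x y z,
  minn (gp x y) (gp y z) <= gp x z + e.
Proof.
case: hypS => _ _ [e h]; exists e => x y z; have := h x y z 1%g.
rewrite !(word_distC genS _ 1%g) !word_dist1.
have := gromov_prod2E x y; have := gromov_prod2E y z; have := gromov_prod2E x z.
lia.
Qed.

Lemma ray_products A C : exists H, forall c, quasigeodesic (word_dist S) A C c ->
  forall i n j, i <= n -> n <= j ->
  d (c i) (c n) + d (c n) (c j) <= d (c i) (c j) + H.
Proof.
case: hypS => _ _ [e h]; apply: (quasigeodesic_products _ _ _ h).
- exact: word_distxx.
- exact: word_distC.
- exact: word_distT.
- exact: word_dist_geodesic.
Qed.

(** Seen from 1, later points of a ray lie behind earlier ones up to a bounded defect. Moving the
    base point from [c 0] to 1 costs [2 * len (c 0)]. *)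
Lemma ray_base_products A C : exists H, forall c, quasigeodesic (word_dist S) A C c ->
  forall i j, i <= j -> 2 * len (c i) <= gp (c i) (c j) + 2 * len (c 0) + H.
Proof.
have [H HP] := ray_products A C; exists H => c qc i j ij.
have := HP c qc 0 i j (leq0n _) ij; have := gromov_prod2E (c i) (c j).
have := word_length_dist (c 0) (c i).
have := word_length_dist (c j) (c 0); rewrite (word_distC genS (c j)).
have := word_distT genS (c 0) 1%g (c j).
rewrite word_dist1 (word_distC genS (c 0) 1%g) word_dist1.
lia.
Qed.

Lemma ray_proper c : quasigeodesic_ray S c ->
  forall r, exists n, forall i, n <= i -> r <= len (c i).
Proof.
move=> [A [C qc]] r; exists (A * (len (c 0) + r) + C).+1 => i ni.
rewrite leqNgt; apply/negP => lt.
have [] := qc 0 i (leq0n _); rewrite subn0 => h _.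
have le : d (c 0) (c i) <= len (c 0) + r.
  have := word_distT genS (c 0) 1%g (c i).
  by rewrite word_dist1 (word_distC genS (c 0) 1%g) word_dist1; lia.
have : A * d (c 0) (c i) <= A * (len (c 0) + r) by rewrite leq_mul2l le orbT.
lia.
Qed.

(** The hypothesis on p places it near a geodesic from 1 to [c j]. The first point of the ray about
    as long as p is also near such a geodesic, and hyperbolicity makes two such points of similar
    length close. *)
Lemma near_of_product c : quasigeodesic_ray S c ->
  forall K, exists n, forall p, (exists j, 2 * len p <= gp p (c j) + K) ->
  exists l, d p (c l) <= n.
Proof.
move=> [A [C qc]] K; have [e hyp] := gromov_prod2_hyp.
have [H HP] := ray_base_products A C; have {HP} base := HP c qc.
have step k : d (c k) (c k.+1) <= A + C := quasigeodesic_step k qc.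
exists (2 * K + 2 * H + 2 * e + 4 * len (c 0) + 2 * (A + C)) => p [j bj].
pose P l := 2 * len p <= 2 * len (c l) + K.
have Pj : P j by rewrite /P; have := gromov_prod2_le (c j) p; rewrite gromov_prod2C; lia.
have exP : exists l, P l by exists j.
case: (ex_minnP exP) => l Pl minl; exists l.
have lj : l <= j by apply: minl.
(* By minimality of l the preceding point is shorter than p; at l = 0 the summand [len (c 0)] takes
   over. *)
have up : len (c l) <= len p + len (c 0) + (A + C).
  case: l Pl minl {lj} => [|l] _ minl; first by lia.
  have : ~~ P l by apply/negP => /minl; rewrite ltnn.
  by rewrite /P -ltnNge; have := step l; have := word_length_dist (c l) (c l.+1); lia.
have := base l j lj; have := hyp p (c j) (c l).
rewrite (gromov_prod2C (c j)); have := gromov_prod2E p (c l).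
by rewrite /P in Pl; lia.
Qed.

Lemma ray_length_le A C c k : quasigeodesic (word_dist S) A C c ->
  len (c k) <= len (c 0) + (A * k + C).
Proof.
move=> qc; have := word_length_dist (c 0) (c k).
by have [_] := qc 0 k (leq0n _); rewrite subn0; lia.
Qed.

Lemma near_of_unbounded_products c c' :
  quasigeodesic_ray S c -> quasigeodesic_ray S c' ->
  (forall r, exists i j, r <= gp (c i) (c' j)) ->
  exists n, forall i, exists j, d (c i) (c' j) <= n.
Proof.
move=> [A [C qc]] qc' unb.
have [e hyp] := gromov_prod2_hyp.
have [H HP] := ray_base_products A C; have {HP} base := HP c qc.
have [n nP] := near_of_product qc' (2 * len (c 0) + H + e).
exists n => i; apply: nP.
(* The product asked for exceeds twice the length of every [c k] with k < i, which forces i <= k. *)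
have [k [j kj]] := unb (2 * len (c i) + 2 * (len (c 0) + (A * i + C)) + 1).
exists j; have ik : i <= k.
  rewrite leqNgt; apply/negP => ki.
  have := gromov_prod2_le (c k) (c' j); have := ray_length_le k qc.
  have : A * k <= A * i by rewrite leq_mul2l ltnW ?orbT.
  by lia.
have := base i k ik; have := hyp (c i) (c k) (c' j); lia.
Qed.

(** Unboundedness is asked only along some pairs of indices, so rays that come close infinitely
    often are covered. *)
Lemma asymptotic_of_products c c' :
  quasigeodesic_ray S c -> quasigeodesic_ray S c' ->
  (forall r, exists i j, r <= gp (c i) (c' j)) -> asymptotic S c c'.
Proof.
move=> qc qc' unb.
have [n near] := near_of_unbounded_products qc qc' unb.
have [|n' near'] := near_of_unbounded_products qc' qc.
  by move=> r; have [i [j h]] := unb r; exists j, i; rewrite gromov_prod2C.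
exists (maxn n n'); split=> _ [i _ <-].
  by have [j h] := near i; exists (c' j); [exists j | rewrite leq_max h].
have [j h] := near' i; exists (c j); first by exists j.
by rewrite word_distC // leq_max h orbT.
Qed.

(** The point [c' m] near [c i] is far from 1, as is [c' j], and two far points of one ray have a
    large product. *)
Lemma asymptotic_products c c' :
  quasigeodesic_ray S c -> quasigeodesic_ray S c' -> asymptotic S c c' ->
  forall r, exists n, forall i j, n <= i -> n <= j -> r <= gp (c i) (c' j).
Proof.
move=> qc qc' [b [near _]] r; have [e hyp] := gromov_prod2_hyp.
case: (qc') => [A [C qc'AC]]; have [H HP] := ray_base_products A C.
have {HP} base := HP c' qc'AC.
have [n1 n1P] := ray_proper qc (r + e + H + 2 * len (c' 0) + 2 * b).
have [n2 n2P] := ray_proper qc' (r + e + H + 2 * len (c' 0) + 2 * b).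
exists (maxn n1 n2) => i j; rewrite !geq_max => /andP[n1i _] /andP[_ n2j].
have {}n1P := n1P i n1i; have {}n2P := n2P j n2j.
have [|_ [m _ <-] cm] := near (c i); first by exists i.
have := word_length_dist (c' m) (c i); rewrite (word_distC genS (c' m)) => lm.
have := gromov_prod2E (c i) (c' m); have := word_length_dist (c i) (c' m).
have := hyp (c i) (c' m) (c' j).
case: (leqP m j) => [mj|/ltnW jm]; first by have := base m j mj; lia.
have := base j m jm; rewrite gromov_prod2C; lia.
Qed.

End GromovProducts.

(** * Quasimorphisms with finite sublevel sets *)

Section CyclicSubgroup.
Variable G : groupType.
Implicit Types g h t : G.

Lemma cyclic_subgroup1 t : cyclic_subgroup t 1%g.
Proof. by exists 0; left; rewrite expg0. Qed.

Lemma cyclic_subgroupM t h : cyclic_subgroup t h -> cyclic_subgroup t (h * t)%g.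
Proof.
move=> [n [->|->]]; first by exists n.+1; left; rewrite expgSr.
case: n => [|n]; first by exists 1; left; rewrite expg0 invg1 mul1g expg1.
by exists n; right; rewrite expgS invgM mulgVK.
Qed.

Lemma cyclic_subgroupMV t h :
  cyclic_subgroup t h -> cyclic_subgroup t (h * t^-1)%g.
Proof.
move=> [n [->|->]]; last by exists n.+1; right; rewrite expgS invgM.
case: n => [|n]; first by exists 1; right; rewrite expg0 expg1 mul1g.
by exists n; left; rewrite expgSr mulgK.
Qed.

(** If b is bounded by 3Q, the group is a sublevel set, hence finite. Otherwise some t has |b t| >
    3Q, and multiplying by powers of t brings every x into one finite sublevel set, which contains
    coset representatives. *)
Lemma quasimorphism_elementary (b : G -> int) (Q : nat) :
  (forall g h, `|b (g * h)%g - (b g + b h)|%R <= Q%:Z)%R ->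
  (forall s : nat, finite_set [set g | `|b g|%R <= s%:Z]%R) ->
  exists t, finite_index (cyclic_subgroup t).
Proof.
move=> bM fin.
case: (pselect (exists t, (3 * Q)%:Z < `|b t|)%R) => [[t tQ]|small]; last first.
  exists 1%g, setT => [|x].
    apply: sub_finite_set (fin (3 * Q)) => g _ /=.
    by rewrite leNgt; apply/negP => ?; apply: small; exists g.
  by exists x, 1%g; split=> //; [exact: cyclic_subgroup1 | rewrite mulg1].
exists t.
wlog t_gt0 : b bM fin tQ / (0 < b t)%R => [wlg|].
  case: (ltP 0%R (b t)) => [|t_le0]; first exact: (wlg b).
  apply: (wlg (fun g => - b g)%R).
  - by move=> g h; have := bM g h; lia.
  - by move=> s; under eq_set do rewrite normrN; apply: fin.
  - by rewrite normrN.
  - by lia.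
(* Multiplication by t or its inverse moves b by at most W, so a step towards 0 from outside [-W, W]
   does not change the sign. *)
pose W : nat := absz (b t) + Q.
exists [set g | `|b g|%R <= W%:Z]%R; first exact: fin.
suff all n x : (`|b x| <= n%:Z + W%:Z)%R ->
    exists k h, [/\ (`|b k| <= W%:Z)%R, cyclic_subgroup t h & x = (k * h)%g].
  by move=> x; apply: (all (absz (b x))); lia.
elim: n x => [|n IH] x xn.
  exists x, 1%g; split; [by lia | exact: cyclic_subgroup1 | by rewrite mulg1].
case: (leP `|b x|%R (W%:Z)%R) => xW.
  exists x, 1%g; split; [by [] | exact: cyclic_subgroup1 | by rewrite mulg1].
have h1 := bM x t; have := bM (x * t^-1)%g t; rewrite mulgVK => h2.
case: (ltP 0%R (b x)) => x0.
  case: (IH (x * t^-1)%g) => [|k [h [kW ht xE]]]; first by lia.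
  exists k, (h * t)%g; split=> //; first exact: cyclic_subgroupM.
  by rewrite mulgA -xE mulgVK.
case: (IH (x * t)%g) => [|k [h [kW ht xE]]]; first by lia.
exists k, (h * t^-1)%g; split=> //; first exact: cyclic_subgroupMV.
by rewrite mulgA -xE mulgK.
Qed.

End CyclicSubgroup.

(** * The Gromov boundary *)

Section BoundaryTheory.
Variables (G : groupType) (S : set G).
Hypothesis hypS : hyperbolic_group S.

Local Notation d := (word_dist S).
Local Notation len := (word_length S).
Local Notation gp := (gromov_prod2 S).
Local Notation bd := (gromov_boundary S).
Implicit Types (xi zeta : bd) (c : nat -> G) (g x y z : G).

Let genS : symmetric_generating S. Proof. by case: hypS. Qed.

Lemma representsP c xi :
  represents c xi -> quasigeodesic_ray S c /\ boundary_class xi = ray_class S c.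
Proof.
rewrite /represents; case: (boundary_classP xi) => c0 qc0 -> [qc ac].
split=> //; apply/seteqP; split=> c' [qc' ac']; split=> //.
  by apply: asymptotic_trans ac'; last exact: asymptotic_sym.
exact: asymptotic_trans ac ac'.
Qed.

Lemma represents_exists xi : exists c, represents c xi.
Proof.
rewrite /represents; case: (boundary_classP xi) => c qc ->.
by exists c; split=> //; exact: asymptotic_refl.
Qed.

Lemma represents_asymptotic c c' xi :
  represents c xi -> represents c' xi -> asymptotic S c c'.
Proof. by move=> /representsP[_]; rewrite /represents => -> []. Qed.

Lemma asymptotic_represents c c' xi : represents c xi ->
  quasigeodesic_ray S c' -> asymptotic S c c' -> represents c' xi.
Proof. by move=> /representsP[_ E] qc' ac; rewrite /represents E. Qed.

Lemma represents_inj c xi zeta : represents c xi -> represents c zeta -> xi = zeta.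
Proof.
move=> /representsP[_ xiE] /representsP[_]; rewrite -xiE.
case: xi zeta {xiE} => X HX [Z HZ] /= E; move: HZ; rewrite E => HZ.
by congr GromovBoundary; apply: Prop_irrelevance.
Qed.

Lemma represents_act g c xi :
  represents c xi -> represents (translate g c) (boundary_act g xi).
Proof. by move=> cx; exists c. Qed.

Lemma boundary_actM g h xi :
  boundary_act (g * h)%g xi = boundary_act g (boundary_act h xi).
Proof.
have [c cx] := represents_exists xi.
apply: (represents_inj (represents_act _ cx)).
have -> : translate (g * h)%g c = translate g (translate h c).
  by apply/funext => k; rewrite /translate mulgA.
by do 2!apply: represents_act.
Qed.

Lemma boundary_act1 xi : boundary_act 1%g xi = xi.
Proof.
have [c cx] := represents_exists xi.
apply: (represents_inj (represents_act _ cx)).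
have -> : translate 1%g c = c by apply/funext => k; rewrite /translate mul1g.
by [].
Qed.

Lemma boundary_actK g : cancel (boundary_act (S := S) g) (boundary_act g^-1%g).
Proof. by move=> xi; rewrite -boundary_actM mulVg boundary_act1. Qed.

(* Only existence of good representatives is required in a shadow, yet at the
   price of a fixed loss all representatives are good. *)
Lemma boundary_shadow_forall : exists K, forall xi zeta r c c',
  boundary_shadow xi (r + K) zeta -> represents c xi -> represents c' zeta ->
  exists n, forall i j, n <= i -> n <= j -> r <= gp (c i) (c' j).
Proof.
have [e hyp] := gromov_prod2_hyp hypS; exists (2 * e).
move=> xi zeta r c c' [c1 [c1' [cx1 cz1 [n1 n1P]]]] cx cz.
have [qc _] := representsP cx; have [qc' _] := representsP cz.
have [qc1 _] := representsP cx1; have [qc1' _] := representsP cz1.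
have [n2 n2P] := asymptotic_products hypS qc qc1
  (represents_asymptotic cx cx1) (r + 2 * e).
have [n3 n3P] := asymptotic_products hypS qc1' qc'
  (represents_asymptotic cz1 cz) (r + 2 * e).
exists (maxn n1 (maxn n2 n3)) => i j; rewrite !geq_max.
move=> /and3P[n1i n2i n3i] /and3P[n1j n2j n3j].
have := n1P i j n1i n1j; have := n2P i i n2i n2i; have := n3P j j n3j n3j.
have := hyp (c i) (c1 i) (c' j); have := hyp (c1 i) (c1' j) (c' j); lia.
Qed.

(** * Shadows as a neighbourhood base, and continuity of the action *)

Lemma boundary_shadow_sym xi zeta r :
  boundary_shadow xi r zeta -> boundary_shadow zeta r xi.
Proof.
move=> [c [c' [cx cz [n nP]]]]; exists c', c; split=> //.
by exists n => i j ni nj; rewrite gromov_prod2C //; apply: nP.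
Qed.

Lemma boundary_shadow_refl xi r : boundary_shadow xi r xi.
Proof.
have [c cx] := represents_exists xi; exists c, c; split=> //.
have [qc _] := representsP cx.
have ac := represents_asymptotic cx cx.
by have [n nP] := asymptotic_products hypS qc qc ac r; exists n.
Qed.

(** The hyperbolic inequality passes to infinity; the fixed loss K is harmless for neighbourhoods
    and for separation. *)
Lemma boundary_shadow_trans : exists K, forall xi zeta omega r,
  boundary_shadow xi (r + K) zeta -> boundary_shadow zeta (r + K) omega ->
  boundary_shadow xi r omega.
Proof.
have [K KP] := boundary_shadow_forall; have [e hyp] := gromov_prod2_hyp hypS.
exists (e + K) => xi zeta omega r; rewrite addnA => sx sz.
have [c1 cx] := represents_exists xi; have [c2 cz] := represents_exists zeta.
have [c3 co] := represents_exists omega.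
have [n1 n1P] := KP _ _ _ _ _ sx cx cz; have [n2 n2P] := KP _ _ _ _ _ sz cz co.
exists c1, c3; split=> //; exists (maxn n1 n2) => i j; rewrite !geq_max.
move=> /andP[n1i n2i] /andP[n1j n2j].
have := n1P i i n1i n1i; have := n2P i j n2i n2j.
by have := hyp (c1 i) (c2 i) (c3 j); lia.
Qed.

Lemma boundary_shadow_eq xi zeta :
  (forall r, boundary_shadow xi r zeta) -> xi = zeta.
Proof.
move=> sh; have [K KP] := boundary_shadow_forall.
have [c cx] := represents_exists xi; have [c' cz] := represents_exists zeta.
have [qc _] := representsP cx; have [qc' _] := representsP cz.
apply: (represents_inj _ cz); apply: (asymptotic_represents cx) => //.
apply: asymptotic_of_products => // r.
by have [n nP] := KP _ _ r _ _ (sh _) cx cz; exists n, n; apply: nP.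
Qed.

(** Shadows are not asserted to be open. The points with some shadow inside [W] do form an open set,
    by quasi-transitivity. *)
Lemma nbhs_boundaryP xi (W : set bd) :
  nbhs xi W <-> exists r, boundary_shadow xi r `<=` W.
Proof.
split=> [|[r rW]].
  by rewrite nbhsE => -[V [oV /oV[r rV] VW]]; exists r; apply: subset_trans VW.
have [K KP] := boundary_shadow_trans.
pose V : set bd := [set zeta | exists s, boundary_shadow zeta s `<=` W].
have oV : boundary_open V.
  move=> zeta [s sW]; exists (s + K) => omega zo; exists (s + K) => om oo.
  exact: sW (KP _ _ _ _ zo oo).
rewrite nbhsE; exists V; first by split=> //; exists r.
by move=> zeta [s sW]; apply: sW; apply: boundary_shadow_refl.
Qed.

Lemma boundary_hausdorff : hausdorff_space bd.
Proof.
have [K KP] := boundary_shadow_trans.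
move=> xi zeta xz; apply: boundary_shadow_eq => r.
have [] := xz (boundary_shadow xi (r + K)) (boundary_shadow zeta (r + K)).
- by apply/nbhs_boundaryP; exists (r + K).
- by apply/nbhs_boundaryP; exists (r + K).
move=> omega [xo /boundary_shadow_sym oz]; exact: KP xo oz.
Qed.

(** Translating by g amounts to moving the base point by [len g], which changes a doubled product by
    at most twice that. *)
Lemma boundary_shadow_act g xi zeta r :
  boundary_shadow xi (r + 2 * len g) zeta ->
  boundary_shadow (boundary_act g xi) r (boundary_act g zeta).
Proof.
move=> [c [c' [cx cz [n nP]]]].
exists (translate g c), (translate g c'); split; try exact: represents_act.
exists n => i j ni nj; have := nP i j ni nj.
have := gromov_prod2E hypS (c i) (c' j).
have := gromov_prod2E hypS (g * c i)%g (g * c' j)%g.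
rewrite word_dist_translate /translate.
have := word_lengthM genS g^-1%g (g * c i)%g.
have := word_lengthM genS g^-1%g (g * c' j)%g.
by rewrite !mulKg word_lengthV //; lia.
Qed.

Lemma boundary_act_continuous g : continuous (boundary_act g : bd -> bd).
Proof.
move=> xi W /nbhs_boundaryP[r rW]; apply/nbhs_boundaryP.
by exists (r + 2 * len g) => zeta /boundary_shadow_act /rW.
Qed.

(* If the two points xi, xi' have bounded product, then one of them has bounded
   product with (c n)^-1, and so is pushed by c n towards the limit of c. *)
Lemma boundary_orbit_dense xi xi' zeta r : xi <> xi' -> exists g,
  boundary_shadow zeta r (boundary_act g xi) \/
  boundary_shadow zeta r (boundary_act g xi').
Proof.
move=> ne; have [e hyp] := gromov_prod2_hyp hypS.
have [a ax] := represents_exists xi; have [a' ax'] := represents_exists xi'.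
have [c cz] := represents_exists zeta.
have [qa _] := representsP ax; have [qa' _] := representsP ax'.
have [qc _] := representsP cz.
have [r0 r0P] : exists r0, forall i j, gp (a i) (a' j) < r0.
  apply: contrapT => no; apply: ne; apply: (represents_inj _ ax').
  apply: (asymptotic_represents ax) => //; apply: asymptotic_of_products => // s.
  apply: contrapT => no'; apply: no; exists s => i j; rewrite ltnNge; apply/negP => le.
  by apply: no'; exists i, j.
case: (qc) => [A [C qcAC]]; have [H HP] := ray_base_products hypS A C.
have {HP} base := HP c qcAC.
have [n nP] := ray_proper hypS qc (r + r0 + 2 * e + H + 2 * len (c 0)).
have {}nP := nP n (leqnn n).
(* The doubled products of [c n] with [c n * b j] and of [(c n)^-1] with [b j] add up to
   [2 * len (c n)], so a bound on the latter makes the former large. *)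
have push (b : nat -> G) (eta : bd) : represents b eta ->
    (forall i, gp (c n)^-1%g (b i) <= r0 + e) ->
    boundary_shadow zeta r (boundary_act (c n) eta).
  move=> br bnd; exists c, (translate (c n) b); split=> //; first exact: represents_act.
  exists n => i j ni _.
  have := bnd j; have := gromov_prod2E hypS (c n)^-1%g (b j).
  have := gromov_prod2E hypS (c n) (c n * b j)%g; have := base n i ni.
  rewrite gromov_prod2C //; have := hyp (c i) (c n) (c n * b j)%g.
  have -> : d (c n)^-1%g (b j) = len (c n * b j)%g by rewrite /word_dist invgK.
  have -> : d (c n) (c n * b j)%g = len (b j) by rewrite /word_dist mulKg.
  by rewrite word_lengthV // /translate; lia.
exists (c n).
case: (pselect (forall i, gp (c n)^-1%g (a i) <= r0 + e)) => [/(push _ _ ax)|].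
  by left.
move=> /existsNP[i /negP]; rewrite -ltnNge => lt; right; apply: (push a') => // j.
rewrite leqNgt; apply/negP => lt'.
have := hyp (a i) (c n)^-1%g (a' j); rewrite (gromov_prod2C hypS (a i)).
by have := r0P i j; lia.
Qed.

End BoundaryTheory.

(** * Groups fixing a boundary point *)

Section BoundaryFixedPoint.
Variables (G : groupType) (S : set G).
Hypothesis hypS : hyperbolic_group S.

Local Notation d := (word_dist S).
Local Notation len := (word_length S).
Local Notation gp := (gromov_prod2 S).

Let genS : symmetric_generating S. Proof. by case: hypS. Qed.
Let finS : finite_set S. Proof. by case: hypS. Qed.

(* The defect does not depend on g: this makes the Busemann function below
   a quasimorphism. *)
Lemma translate_ray_products c : quasigeodesic_ray S c ->
  exists H, forall g, exists n, forall k l, n <= k -> k <= l ->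
  len (g * c k)%g + d (c k) (c l) <= len (g * c l)%g + H.
Proof.
move=> qc; case: (qc) => [A [C qcAC]]; have [H HP] := ray_products hypS A C.
have {HP} prod := HP c qcAC; case: hypS => _ _ [e d4].
exists (H + e) => g.
(* Beyond n the translate is so far from 1 that the first alternative of the four-point condition is
   impossible. *)
have [n nP] :=
  ray_proper hypS (quasigeodesic_translate g qc) (len (g * c 0)%g + e + H + 1).
exists n => k l nk kl; have := nP k nk; have := prod 0 k l (leq0n k) kl.
have := d4 (g * c 0)%g 1%g (g * c l)%g (g * c k)%g.
rewrite !word_dist_translate (word_distC genS (g * c 0)%g 1%g) !word_dist1.
rewrite (word_distC genS (c l) (c k)) /translate; lia.
Qed.

(** Asymptoticity alone gives a bound depending on g. Far out, however, [g * c k] is near a geodesic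
    from 1 to some [c l], with a defect [H1 + e] independent of g; only the threshold n depends on
    g. *)
Lemma translate_ray_near c : quasigeodesic_ray S c ->
  (forall g, asymptotic S c (translate g c)) ->
  exists H, forall g, exists n, forall k, n <= k -> exists m, d (g * c k)%g (c m) <= H.
Proof.
move=> qc fix_c; have [e hyp] := gromov_prod2_hyp hypS.
have [H1 H1P] := translate_ray_products qc.
have [H HP] := near_of_product hypS qc (H1 + e).
exists H => g; have [n nP] := H1P g; exists n => k nk; apply: HP.
have [n' n'P] := asymptotic_products hypS (quasigeodesic_translate g qc) qc
  (asymptotic_sym genS (fix_c g)) (2 * len (g * c k)%g).
pose l := maxn n' k; have kl : k <= l by rewrite /l; lia.
have n'l : n' <= l by rewrite /l; lia.
exists l; have := n'P l l n'l n'l; have := nP k l nk kl; rewrite /translate.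
have := hyp (g * c k)%g (g * c l)%g (c l).
have := gromov_prod2E hypS (g * c k)%g (g * c l)%g; rewrite word_dist_translate.
by lia.
Qed.

(** The coarse limit b of [len (g * c k) - len (c k)] is a Busemann function. Since [h * c k] is
    uniformly near the ray, b is a quasimorphism; if b g is bounded, g moves far points of the ray a
    bounded distance, which leaves finitely many g. *)
Lemma boundary_fixed_point_elementary (xi : gromov_boundary S) :
  (forall g, boundary_act g xi = xi) ->
  exists t : G, finite_index (cyclic_subgroup t).
Proof.
move=> fix_xi; have [c cx] := represents_exists hypS xi.
have [qc _] := representsP hypS cx.
have fix_c g : asymptotic S c (translate g c).
  by have := represents_act g cx; rewrite fix_xi; apply: represents_asymptotic cx.
case: (qc) => [A [C qcAC]].
have [H0 H0P] := ray_base_products hypS A C; have {H0P} base := H0P c qcAC.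
have [H1 H1P] := translate_ray_products qc.
have [H2 H2P] := translate_ray_near qc fix_c.
pose beta g k : int := ((len (g * c k)%g)%:Z - (len (c k))%:Z)%R.
(* Past a late index m, both [len (g * c k)] and [len (c k)] grow by [d (c m) (c k)] up to H1, so
   any late value of [beta g] serves. *)
have /choice[b bP] g : exists z : int, exists n, forall k, n <= k ->
    (`|beta g k - z| <= H1%:Z)%R.
  have [n nP] := H1P g; have [n' n'P] := H1P 1%g.
  exists (beta g (maxn n n')), (maxn n n') => k; set m := maxn n n' => mk.
  have := nP m k; have := n'P m k; rewrite !mul1g /beta.
  have := word_length_dist hypS (g * c m)%g (g * c k)%g.
  have := word_length_dist hypS (c m) (c k); rewrite word_dist_translate.
  have nm : n <= m by rewrite /m; lia.
  have n'm : n' <= m by rewrite /m; lia.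
  by move=> h1 h2 /(_ n'm mk) h3 /(_ nm mk) h4; lia.
have far n : exists r, forall m, r <= len (c m) -> n <= m.
  exists (len (c 0) + (A * n + C) + 1) => m rm; rewrite leqNgt; apply/negP => mn.
  have := ray_length_le hypS m qcAC.
  have : A * m <= A * n by rewrite leq_mul2l ltnW ?orbT.
  by lia.
(* Approximating b at g, h and gh costs H1 each; exchanging [h * c k] for a nearby [c m] costs H2
   twice. *)
apply: (@quasimorphism_elementary _ b (3 * H1 + 2 * H2)) => [g h|s].
  have [n1 n1P] := bP g; have [n2 n2P] := bP h; have [n3 n3P] := bP (g * h)%g.
  have [n4 n4P] := H2P h; have [r rP] := far n1.
  have [n5 n5P] := ray_proper hypS (quasigeodesic_translate h qc) (r + H2).
  pose k := maxn n2 (maxn n3 (maxn n4 n5)).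
  have := n2P k; have := n3P k; have := n4P k; have := n5P k.
  rewrite /translate /k !leq_max !leqnn !orbT -/k.
  move=> /(_ isT) rk /(_ isT) [m mk] /(_ isT) b3 /(_ isT) b2.
  have := word_length_dist hypS (c m) (h * c k)%g; rewrite (word_distC genS (c m)) => le1.
  have le2 := word_length_dist hypS (h * c k)%g (c m).
  have /n1P : n1 <= m by apply: rP; lia.
  have := word_length_dist hypS (g * c m)%g (g * (h * c k))%g.
  rewrite (word_distC genS (g * c m)%g) word_dist_translate.
  have := word_length_dist hypS (g * (h * c k))%g (g * c m)%g.
  have ghE : (g * h * c k)%g = (g * (h * c k))%g by rewrite mulgA.
  by rewrite word_dist_translate; rewrite /beta ghE in b2 b3 *; lia.
(* [g * c k] is within H2 of some [c m], whose length differs from that of [c k] by at most s + H1 +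
   H2; points of one ray with similar lengths are close. *)
pose s' := s + H1 + H2 + 2 * len (c 0) + H0 + H2.
have close g : (`|b g| <= s%:Z)%R -> exists n, forall k, n <= k ->
    d (g * c k)%g (c k) <= s'.
  move=> bs; have [n nP] := bP g; have [n' n'P] := H2P g.
  exists (maxn n n') => k; rewrite geq_max => /andP[/nP bk /n'P[m mk]].
  have := word_length_dist hypS (c m) (g * c k)%g; rewrite (word_distC genS (c m)) => le1.
  have le2 := word_length_dist hypS (g * c k)%g (c m).
  have := word_distT genS (g * c k)%g (c m) (c k).
  have := gromov_prod2E hypS (c m) (c k); rewrite /beta in bk.
  case: (leqP m k) => [/base|/ltnW/base]; first by rewrite /s'; lia.
  by rewrite gromov_prod2C // /s'; lia.
(* For large k, g |-> (g c_k)^-1 c_k injects a finite set of such g into a ball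
   of fixed radius. *)
apply: contrapT => inf.
have [X ballE] : exists X : seq G, [set g | len g <= s'] = [set` X].
  by apply/finite_seqP; apply: finite_word_ball.
have [B Bs szB] := infinite_set_fset (size X).+1 inf.
have [k kP] : exists k, forall g, g \in finmap.enum_fset B -> d (g * c k)%g (c k) <= s'.
  have {}Bs g : g \in finmap.enum_fset B -> (`|b g| <= s%:Z)%R by apply: Bs.
  suff [k kP] : exists k, forall k', k <= k' -> forall g,
      g \in finmap.enum_fset B -> d (g * c k')%g (c k') <= s'.
    by exists k; apply: kP.
  elim: (finmap.enum_fset B) Bs => [|h l IH] Bs; first by exists 0.
  have [|k1 k1P] := IH; first by move=> x xl; apply: Bs; rewrite inE xl orbT.
  have [|k2 k2P] := close h; first by apply: Bs; rewrite inE eqxx.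
  exists (maxn k1 k2) => k'; rewrite geq_max => /andP[kk1 kk2] x.
  by rewrite inE => /orP[/eqP ->|xl]; [apply: k2P | apply: k1P].
pose conj g := ((g * c k)^-1 * c k)%g.
have : uniq (map conj (finmap.enum_fset B)).
  rewrite map_inj_uniq ?finmap.fset_uniq // => x y /mulIg /invg_inj; exact: mulIg.
move=> /(@uniq_leq_size _ _ X); rewrite size_map => le.
suff : size (finmap.enum_fset B) <= size X by lia.
apply: le => x /mapP[g gB ->].
suff : [set` X] (conj g) by [].
by rewrite -ballE /=; apply: kP.
Qed.

End BoundaryFixedPoint.

Local Open Scope ring_scope.

(** * Codes *)

(** [code_ray] shifted by one index so as to start at 1: the inverse of [code_prod alpha k] carries
    x to the k-th point of its orbit. *)
Definition code_prod (R : realType) (G : groupType) (M : Type) (D : datum R G M)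
  (alpha : nat -> idx D) (k : nat) : G := (\prod_(i < k) gen (alpha i))%g.

Section Codes.
Variables (R : realType) (G : groupType) (M : metricType R).
Variables (rho : G -> M -> M) (Lam : set M).
Hypothesis act : LHomeo_action rho.
Hypothesis inv : invariant_set rho Lam.
Implicit Types (D : datum R G M) (g h : G) (x y p : M).

Lemma action_continuous g : continuous (rho g).
Proof. by case: act => /(_ g)[[f' []]]. Qed.

Let rho1 x : rho 1%g x = x. Proof. by case: act. Qed.
Let rhoM g h x : rho (g * h)%g x = rho g (rho h x). Proof. by case: act. Qed.

Lemma code_prodS D (alpha : nat -> idx D) k :
  code_prod alpha k.+1 = (code_prod alpha k * gen (alpha k))%g.
Proof. by rewrite /code_prod big_ord_recr. Qed.

Lemma code_prodD D (alpha : nat -> idx D) m k :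
  code_prod alpha (m + k) =
  (code_prod alpha m * code_prod (fun l => alpha (m + l)) k)%g.
Proof.
elim: k => [|k IH]; first by rewrite addn0 /code_prod big_ord0 mulg1.
by rewrite addnS !code_prodS IH mulgA.
Qed.

Lemma eq_code_prod D D' (alpha : nat -> idx D) (beta : nat -> idx D') k :
  (forall i, (i < k)%N -> gen (alpha i) = gen (beta i)) ->
  code_prod alpha k = code_prod beta k.
Proof. by move=> eq_ab; apply: eq_bigr => i _; apply: eq_ab. Qed.

Lemma code_orbitE D x (alpha : nat -> idx D) k :
  code_orbit rho x alpha k = rho (code_prod alpha k)^-1%g x.
Proof.
elim: k => [|k IH]; first by rewrite /code_prod big_ord0 invg1 rho1.
by rewrite code_prodS invgM rhoM -IH.
Qed.

Lemma spelled_code_prod D (alpha : nat -> idx D) k :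
  spelled (range (gen (d := D))) k (code_prod alpha k).
Proof.
exists [seq gen (alpha i) | i <- iota 0 k]; split.
- by rewrite size_map size_iota.
- by move=> _ /mapP[i _ ->]; exists (alpha i).
- rewrite big_map /code_prod -(big_mkord xpredT (fun i => gen (alpha i))).
  by rewrite /index_iota subn0.
Qed.

(** The supremum of the Lebesgue numbers need not obviously be attained. If no member of the finite
    cover contained the open ball, the missed points would lie within some m < [dlt D] of x,
    contradicting a Lebesgue number above m. *)
Lemma expansion_cover_ball D x : expansion_datum rho Lam D -> Lam x ->
  exists i : idx D, ball x (dlt D) `<=` cov i.
Proof.
move=> [[_ cover] _ [d0 dsup] _ _] Lx; apply: contrapT => no.
have /choice[y yP] (i : idx D) : exists y, ball x (dlt D) y /\ ~ cov i y.
  apply: contrapT => no'; apply: no; exists i => z xz.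
  by apply: contrapT => nz; apply: no'; exists z.
pose m := \big[Num.max/0]_i mdist x (y i).
have md : m < dlt D.
  by apply: bigmax_lt => // i _; have [] := yP i; rewrite ballEmdist.
have /ereal_sup_gt[_ [e [e0 eP] <-]] : (m%:E < sup_lebesgue Lam (cov (d := D)))%E.
  by apply: lt_le_trans dsup; rewrite lte_fin.
rewrite lte_fin => me; have [i xi] := eP x Lx; have [_] := yP i; apply; apply: xi.
by rewrite ballEmdist /=; apply: le_lt_trans me; apply: le_bigmax.
Qed.

(* These codes also satisfy the ball condition at k = 0. *)
Lemma strict_code_exists D x : expansion_datum rho Lam D -> Lam x ->
  exists alpha : nat -> idx D, forall k,
    ball (rho (code_prod alpha k)^-1%g x) (dlt D) `<=` cov (alpha k).
Proof.
move=> exD Lx; have [i0 _] := expansion_cover_ball exD Lx.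
have /choice[f fP] y : exists i : idx D, Lam y -> ball y (dlt D) `<=` cov i.
  case: (pselect (Lam y)) => [/(expansion_cover_ball exD)[i iP]|nL]; first by exists i.
  by exists i0.
pose p k := iter k (fun y => rho (gen (f y))^-1%g y) x.
have pE k : rho (code_prod (f \o p) k)^-1%g x = p k.
  elim: k => [|k IH]; first by rewrite /code_prod big_ord0 invg1 rho1.
  by rewrite code_prodS invgM rhoM IH.
exists (f \o p) => k; rewrite pE; apply: fP; rewrite -pE; exact: inv.
Qed.

(** Only k open sets are visited, so a point close enough to x follows x through all of them and the
    expansion factors multiply. *)
Lemma expanding_code D x (alpha : nat -> idx D) k : expansion_datum rho Lam D ->
  (forall k, cov (alpha k) (rho (code_prod alpha k)^-1%g x)) ->
  \forall y \near x, xpn D ^+ k * mdist x y <=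
    mdist (rho (code_prod alpha k)^-1%g x) (rho (code_prod alpha k)^-1%g y).
Proof.
move=> [[oU _] /andP[l1 _] _ ex _] xU; elim: k => [|k IH].
  by apply: nearW => y; rewrite /code_prod big_ord0 invg1 !rho1 expr0 mul1r.
have near_k : \forall y \near x, cov (alpha k) (rho (code_prod alpha k)^-1%g y).
  by apply: action_continuous; apply: open_nbhs_nbhs; split; [exact: oU|exact: xU].
near=> y; rewrite code_prodS invgM !rhoM.
have [_ [/(_ _ _ (xU k)) exk _]] := ex (alpha k).
apply: le_trans (exk _ _); last by near: y.
rewrite exprS -mulrA ler_wpM2l //; first by apply: ltW; apply: lt_trans l1.
by near: y.
Unshelve. all: by end_near.
Qed.

Lemma lipschitz_word D n g p : expansion_datum rho Lam D -> Lam p ->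
  spelled (range (gen (d := D))) n g ->
  \forall y \near p, mdist (rho g p) (rho g y) <= lip D ^+ n * mdist p y.
Proof.
move=> [_ /andP[l1 lL] [d0 _] ex [sym _]] Lp [w [<- wS ->]] {n g}.
elim: w wS => [|s w IH] wS.
  by apply: nearW => y; rewrite big_nil !rho1 expr0 mul1r.
have {}IH := IH (fun a aw => wS a (mem_behead (s := s :: w) aw)).
(* The datum controls the inverses of the generators; by symmetry s is itself such an inverse. *)
have [j _ sE] : range (gen (d := D)) s^-1%g by apply: sym; apply: wS; rewrite inE eqxx.
set h := (\prod_(a <- w) a)%g in IH *.
have near_h : \forall y \near p, ball (rho h p) (dlt D) (rho h y).
  by apply: action_continuous; apply: nbhsx_ballx.
have [lips _] := ex j; rewrite sE invgK in lips.
near=> y; rewrite big_cons -/h !rhoM /= exprS -mulrA.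
apply: le_trans (lips _ _ _ _) _.
- by exists (rho h p); [exact: inv | exact: ballxx].
- by exists (rho h p); [exact: inv | near: y].
by apply: ler_wpM2l; [apply: ltW; apply: lt_le_trans lL; apply: lt_trans l1 | near: y].
Unshelve. all: by end_near.
Qed.

(** With L <= lam^A, the comparison lam^k <= L^n becomes k <= A n. *)
Lemma exprn_unbounded (lam L : R) : 1 < lam -> exists A, L <= lam ^+ A.
Proof.
move=> l1; have bern n : n%:R * (lam - 1) <= lam ^+ n.
  elim: n => [|n IH]; first by rewrite mul0r.
  have : 1 <= lam ^+ n by apply: exprn_ege1; apply: ltW.
  by rewrite exprS mulrSr; set u := lam ^+ n in IH *; nra.
have l0 : 0 < lam - 1 by lra.
exists (Num.Def.archi_bound (`|L| / (lam - 1))); apply: le_trans (bern _).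
rewrite -ler_pdivrMr //; apply: ltW; apply: le_lt_trans (archi_boundP _); last first.
  by rewrite divr_ge0 // ltW.
by rewrite ler_pM2r ?invr_gt0 // ler_norm.
Qed.

Hypothesis nonisolated : forall x, Lam x -> ~ isolated [set: M] x.

(* An element spelled with n generators is L^n-Lipschitz near a point of Lam,
   whereas the inverse of c_i^-1 c_j expands by lam^(j - i); compare both at a
   nearby point. *)
Lemma code_prod_length D : expansion_datum rho Lam D ->
  exists A, forall x (alpha : nat -> idx D) k, Lam x ->
  (forall k, cov (alpha k) (rho (code_prod alpha k)^-1%g x)) ->
  (k <= A * word_length (range (gen (d := D))) (code_prod alpha k))%N.
Proof.
move=> exD; have [_ /andP[l1 lL] _ _ genD] := exD.
have [A LA] := exprn_unbounded (lip D) l1.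
exists A => x alpha k Lx xU.
have [spw _] := word_lengthP genD (code_prod alpha k).
set n := word_length _ _ in spw *.
have near_lip := lipschitz_word exD Lx (spelledV genD spw).
have near_exp := expanding_code k exD xU.
pose g := (code_prod alpha k)^-1%g.
pose P := [set y | mdist (rho g x) (rho g y) <= lip D ^+ n * mdist x y /\
  xpn D ^+ k * mdist x y <= mdist (rho g x) (rho g y)].
have nbhsP : nbhs x P by exact: filterI near_lip near_exp.
have [y [[lipy expy] yx]] : exists y, P y /\ y <> x.
  apply: contrapT => no; apply: (nonisolated Lx); split; first by rewrite inE.
  exists P => //; rewrite setIT; apply/seteqP; split=> [y yP|y ->] /=.
    by apply: contrapT => yx; apply: no; exists y.
  exact: nbhs_singleton.
have xy0 : 0 < mdist x y by rewrite mdist_gt0; apply/eqP => /esym.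
have := le_trans expy lipy; rewrite ler_pM2r // => le.
rewrite -(ler_eXn2l l1); apply: le_trans le _.
rewrite exprM lerXn2r // ?nnegrE.
  by apply: ltW; apply: lt_le_trans lL; apply: lt_trans l1.
by apply: exprn_ge0; apply: ltW; apply: lt_trans l1.
Qed.

(** A stretch of the ray is a code product at the orbit point reached after i+1 steps, where the
    exempt index 0 no longer matters. Its length is bounded below by expansion and above by its
    number of letters. *)
Lemma code_ray_quasigeodesic D (S : set G) : finite_set S ->
  symmetric_generating S -> expansion_datum rho Lam D ->
  exists A C, forall x eta (alpha : nat -> idx D), 0 < eta -> Lam x ->
  is_code rho eta x alpha -> quasigeodesic (word_dist S) A C (code_ray alpha).
Proof.
move=> finS genS exD; have [_ _ _ _ genD] := exD.
have [A AP] := code_prod_length exD.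
have finD : finite_set (range (gen (d := D))) by apply: finite_image.
have [K KP] := word_length_change finD genD genS.
have [K' K'P] := word_length_change finS genS genD.
exists (K + A * K')%N, 0%N => x eta alpha eta0 Lx code i j ij.
have -> : word_dist S (code_ray alpha i) (code_ray alpha j) =
    word_length S (code_prod (fun l => alpha (i.+1 + l)) (j - i)).
  rewrite /word_dist /code_ray -/(code_prod alpha i.+1) -/(code_prod alpha j.+1).
  by rewrite -{1}(subnKC ij) -addSn code_prodD mulKg.
set g := code_prod _ _.
have le1 : (j - i <= A * word_length (range (gen (d := D))) g)%N.
  apply: (AP (code_orbit rho x alpha i.+1)); first by rewrite code_orbitE; apply: inv.
  move=> k; rewrite code_orbitE -rhoM -invgM -code_prodD -code_orbitE.
  by apply: (code (i.+1 + k)%N) => //; apply: ballxx.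
have le2 : (word_length (range (gen (d := D))) g <= j - i)%N.
  by apply: word_length_le => //; apply: spelled_code_prod.
have le3 := KP g; have le4 := K'P g; rewrite !addn0.
split; first by move: (word_length _ g) (word_length S g) le1 le4 => u v; nia.
by move: (word_length _ g) (word_length S g) le2 le3 => u v; nia.
Qed.

End Codes.

(** * The postal map *)

Section PostalMap.
Variables (R : realType) (G : groupType) (S : set G) (M : metricType R).
Variables (rho : G -> M -> M) (Lam : set M) (D0 D : datum R G M) (N : nat).
Hypothesis hypS : hyperbolic_group S.
Hypothesis act : LHomeo_action rho.
Hypothesis inv : invariant_set rho Lam.
Hypothesis nonisolated : forall x, Lam x -> ~ isolated [set: M] x.
Hypothesis meander : meandering_hyperbolic rho Lam D0 D N.
Implicit Types (g h : G) (x y : M) (c : nat -> G).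

Local Notation bd := (gromov_boundary S).

Let genS : symmetric_generating S. Proof. by case: hypS. Qed.
Let finS : finite_set S. Proof. by case: hypS. Qed.
Let rho1 x : rho 1%g x = x. Proof. by case: act. Qed.
Let rhoM g h x : rho (g * h)%g x = rho g (rho h x). Proof. by case: act. Qed.
Let exD0 : expansion_datum rho Lam D0. Proof. by case: meander. Qed.
Let exD : expansion_datum rho Lam D. Proof. by case: meander. Qed.

Lemma Ray_quasigeodesic (E : datum R G M) x c : expansion_datum rho Lam E -> Lam x ->
  Ray rho E (dlt E) x c -> quasigeodesic_ray S c.
Proof.
move=> exE Lx [alpha code ->]; have [_ _ [d0 _] _ _] := exE.
have [A [C AC]] := code_ray_quasigeodesic act inv nonisolated finS genS exE.
by exists A, C; apply: AC code.
Qed.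

Lemma asymptotic_subray c c' m : quasigeodesic_ray S c -> quasigeodesic_ray S c' ->
  (forall k, c (m + k)%N = c' k) -> asymptotic S c c'.
Proof.
move=> qc qc' E; apply: asymptotic_of_products => // r.
have [n nP] := ray_proper hypS qc r.
exists (m + n)%N, n; rewrite -E; have := gromov_prod2E hypS (c (m + n)%N) (c (m + n)%N).
by rewrite word_distxx //; have := nP (m + n)%N (leq_addl _ _); lia.
Qed.

(** Along P, points arbitrarily far from 1 lie within K N of the other ray, so the products are
    unbounded. *)
Lemma ray_close_asymptotic x c c' : Lam x ->
  ray_close rho D (dlt D) N x c c' -> asymptotic S c c'.
Proof.
move=> Lx [rc rc' [P [Q [infP _ [near _]]]]].
have qc := Ray_quasigeodesic exD Lx rc; have qc' := Ray_quasigeodesic exD Lx rc'.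
have [_ _ _ _ genD] := exD.
have finD : finite_set (range (gen (d := D))) by apply: finite_image.
have [K KP] := word_length_change finD genD genS.
apply: asymptotic_of_products => // r.
have [n nP] := ray_proper hypS qc (r + K * N).
have [k Pk nk] : exists2 k, P k & (n <= k)%N.
  apply: contrapT => no; apply: infP; apply: sub_finite_set (finite_II n) => k Pk /=.
  by rewrite ltnNge; apply/negP => nk; apply: no; exists k.
have [|_ [j _ <-] le] := near (c k); first by exists k.
exists k, j; have := gromov_prod2E hypS (c k) (c' j).
have := word_length_dist hypS (c' j) (c k); rewrite (word_distC genS (c' j)).
have : (word_dist S (c k) (c' j) <= K * N)%N.
  by apply: leq_trans (KP _) _; rewrite leq_mul2l le orbT.
by have := nP k nk; lia.
Qed.

Lemma Ray_asymptotic x c c' : Lam x ->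
  Ray rho D0 (dlt D0) x c -> Ray rho D0 (dlt D0) x c' ->
  asymptotic S c c'.
Proof.
move=> Lx rc rc'; have [_ _ _ _ /(_ x Lx c c' rc rc') eq] := meander.
elim: eq => {c c' rc rc'}.
- by move=> c c'; apply: ray_close_asymptotic.
- by move=> c; apply: asymptotic_refl.
- by move=> c c' _; apply: asymptotic_sym.
- by move=> c1 c2 c3 _ h12 _; apply: asymptotic_trans.
Qed.

Lemma strict_code_Ray (E : datum R G M) x (alpha : nat -> idx E) :
  (forall k, ball (rho (code_prod alpha k)^-1%g x) (dlt E) `<=` cov (alpha k)) ->
  Ray rho E (dlt E) x (code_ray alpha).
Proof. by move=> aP; exists alpha => // k _; rewrite code_orbitE. Qed.

Lemma Ray_exists x : Lam x -> Ray rho D0 (dlt D0) x !=set0.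
Proof.
move=> Lx; have [alpha aP] := strict_code_exists act inv exD0 Lx.
by exists (code_ray alpha); apply: strict_code_Ray.
Qed.

Lemma postal_exists : Lam !=set0 -> exists post : M -> bd, forall x, Lam x ->
  forall c, Ray rho D0 (dlt D0) x c -> represents c (post x).
Proof.
have point c : quasigeodesic_ray S c -> exists xi : bd, represents c xi.
  move=> qc; have cP : exists2 c', quasigeodesic_ray S c' &
      ray_class S c = ray_class S c'.
    by exists c.
  by exists (GromovBoundary cP); split=> //; apply: asymptotic_refl.
move=> [x0 Lx0]; have [c0 r0] := Ray_exists Lx0.
(* [xi0] is the junk value of the map outside [Lam]. *)
have [xi0 _] := point _ (Ray_quasigeodesic exD0 Lx0 r0).
suff /choice[post postP] x : exists xi : bd, Lam x ->
    forall c, Ray rho D0 (dlt D0) x c -> represents c xi by exists post.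
case: (pselect (Lam x)) => [Lx|nL]; last by exists xi0.
have [c rc] := Ray_exists Lx; have [xi cx] := point _ (Ray_quasigeodesic exD0 Lx rc).
exists xi => _ c' rc'; apply: (asymptotic_represents hypS cx).
  exact: Ray_quasigeodesic rc'.
exact: Ray_asymptotic rc rc'.
Qed.

Variable post : M -> bd.
Hypothesis postP : forall x, Lam x ->
  forall c, Ray rho D0 (dlt D0) x c -> represents c (post x).

(* Since codes are unconstrained at k = 0, prepending gen i to a strict code of x
   gives a code of rho (gen i) x. *)
Lemma postal_gen (i : idx D0) x : Lam x ->
  post (rho (gen i) x) = boundary_act (gen i) (post x).
Proof.
move=> Lx; have [alpha aP] := strict_code_exists act inv exD0 Lx.
have Ly : Lam (rho (gen i) x) by exact: inv.
pose beta k := if k is k'.+1 then alpha k' else i.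
have bE k : code_prod beta k.+1 = (gen i * code_prod alpha k)%g.
  by rewrite /code_prod big_ord_recl.
have rb : Ray rho D0 (dlt D0) (rho (gen i) x) (code_ray beta).
  exists beta => // -[//|k] _; rewrite code_orbitE // bE invgM rhoM
    -[rho (gen i)^-1%g _]rhoM.
  by rewrite mulVg rho1; apply: aP.
have ra := strict_code_Ray aP.
apply: (represents_inj hypS _ (represents_act (gen i) (postP Lx ra))).
apply: (asymptotic_represents hypS (postP Ly rb)).
  by apply: quasigeodesic_translate; apply: Ray_quasigeodesic ra.
apply: (@asymptotic_subray _ _ 1); first exact: Ray_quasigeodesic rb.
  by apply: quasigeodesic_translate; apply: Ray_quasigeodesic ra.
by move=> k; rewrite add1n /code_ray -/(code_prod beta k.+2) bE.
Qed.

Lemma postal_equivariant g x : Lam x -> post (rho g x) = boundary_act g (post x).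
Proof.
move=> Lx; have [_ _ _ _ [_ /(_ g)[n [w [_ wS ->]]]]] := exD0.
elim: w wS => [|s w IH] wS; first by rewrite big_nil rho1 boundary_act1.
have [i _ sE] : range (gen (d := D0)) s by apply: wS; rewrite inE eqxx.
rewrite big_cons rhoM -sE postal_gen; last exact: inv.
rewrite IH ?boundary_actM // => a aw; apply: wS.
by rewrite inE aw orbT.
Qed.

(* For y near x, a D0-code of x serves for n steps as a D-code of y, thanks to
   dlt D < dlt D0; afterwards it may be continued by a D0-code of the point
   reached, and still represents post y. *)
Lemma postal_fellow_travel x (alpha : nat -> idx D0) n : Lam x ->
  (forall k, ball (rho (code_prod alpha k)^-1%g x) (dlt D0) `<=` cov (alpha k)) ->
  \forall y \near x, Lam y -> exists c,
    [/\ Ray rho D (dlt D) y c, represents c (post y) &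
        forall k, (k < n)%N -> c k = code_ray alpha k].
Proof.
move=> Lx aP; have [_ _ [[phi [_ phiP]] dD _ _] _ _] := meander.
(* The radius is the slack that puts a ball of radius [dlt D] around the orbit point of y inside the
   ball of radius [dlt D0] around that of x. *)
have near_n : \forall y \near x, forall k, (k < n)%N ->
    ball (rho (code_prod alpha k)^-1%g x) (dlt D0 - dlt D)
      (rho (code_prod alpha k)^-1%g y).
  elim: n => [|n IH]; first by apply: nearW.
  have near_k : \forall y \near x,
      ball (rho (code_prod alpha n)^-1%g x) (dlt D0 - dlt D)
        (rho (code_prod alpha n)^-1%g y).
    by apply: action_continuous => //; apply: nbhsx_ballx; rewrite subr_gt0.
  apply: filterS2 IH near_k => y yP yn k; rewrite ltnS leq_eqVlt => /orP[/eqP -> //|].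
  exact: yP.
apply: filterS near_n => y yP Ly.
set g := code_prod alpha n in yP *.
have Lq : Lam (rho g^-1%g y) by exact: inv.
have [alpha' a'P] := strict_code_exists act inv exD0 Lq.
pose beta k := phi (if (k < n)%N then alpha k else alpha' (k - n)%N).
have genphi i : gen (phi i) = gen i by case: (phiP i).
have bE k : (k <= n)%N -> code_prod beta k = code_prod alpha k.
  by move=> kn; apply: eq_code_prod => i ik; rewrite /beta genphi (leq_trans ik kn).
have bE' k : code_prod beta (n + k) = (g * code_prod alpha' k)%g.
  rewrite code_prodD bE //; congr (_ * _)%g; apply: eq_code_prod => i _.
  by rewrite /beta genphi ltnNge leq_addr /= addKn.
have rb : Ray rho D (dlt D) y (code_ray beta).
  apply: strict_code_Ray => k; case: (ltnP k n) => kn.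
    rewrite bE ?(ltnW kn) // /beta kn => z yz; have [covphi _] := phiP (alpha k).
    apply: covphi; apply: aP; have := ball_triangle (yP k kn) yz.
    by rewrite subrK.
  rewrite -(subnKC kn) bE' invgM rhoM /beta subnKC // ltnNge kn /=.
  move=> z yz; have [covphi _] := phiP (alpha' (k - n)%N).
  by apply: covphi; apply: a'P; apply: le_ball yz; apply: ltW.
exists (code_ray beta); split=> //; last first.
  by move=> k kn; rewrite /code_ray -/(code_prod beta k.+1) bE.
have ra' := strict_code_Ray a'P.
(* The constructed ray is only a D-ray, so [postP] does not apply to it; its tail, however, is the
   g-translate of a D0-ray of [rho g^-1 y], and equivariance identifies the endpoint. *)
have := represents_act g (postP Lq ra'); rewrite -postal_equivariant //.
rewrite -rhoM mulgV rho1 => rep.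
have qb := Ray_quasigeodesic exD Ly rb.
apply: (asymptotic_represents hypS rep) => //; apply: asymptotic_sym => //.
apply: (@asymptotic_subray _ _ n) => //; first by have [] := representsP hypS rep.
by move=> k; rewrite /code_ray -/(code_prod beta _) -addnS bE'.
Qed.

(** Rays representing the images of x and y agree with c up to index m. As D-rays they share their
    constants, so both continue behind the long element [c m], which forces a large product. *)
Lemma postal_near x r : Lam x ->
  \forall y \near x, Lam y -> boundary_shadow (post x) r (post y).
Proof.
move=> Lx; have [alpha aP] := strict_code_exists act inv exD0 Lx.
have [A [C AC]] := code_ray_quasigeodesic act inv nonisolated finS genS exD.
have [_ _ [dD _] _ _] := exD.
have qD y c : Lam y -> Ray rho D (dlt D) y c -> quasigeodesic (word_dist S) A C c.
  by move=> Ly [b bP ->]; apply: AC bP.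
have [H HP] := ray_base_products hypS A C; have [e hyp] := gromov_prod2_hyp hypS.
have ra := strict_code_Ray aP; have qa := Ray_quasigeodesic exD0 Lx ra.
set c := code_ray alpha in ra qa.
have [m mP] := ray_proper hypS qa (r + 2 * word_length S (c 0%N) + H + e).
have near_m := postal_fellow_travel m.+1 Lx aP.
have [c1 [rc1 rep1 c1E]] := nbhs_singleton near_m Lx.
apply: filterS near_m => y yP Ly; have [c2 [rc2 rep2 c2E]] := yP Ly.
exists c1, c2; split=> //; exists m => i j mi mj.
have b1 := HP c1 (qD _ _ Lx rc1) m i mi; have b2 := HP c2 (qD _ _ Ly rc2) m j mj.
rewrite (c1E m) // (c1E 0%N) // -/c in b1; rewrite (c2E m) // (c2E 0%N) // -/c in b2.
have := hyp (c1 i) (c m) (c2 j); rewrite (gromov_prod2C hypS (c1 i) (c m)).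
by have := mP m (leqnn m); lia.
Qed.

(** * Images of compact sets under the postal map *)

Lemma postal_image_closed (K : set M) : K `<=` Lam -> compact K -> closed (post @` K).
Proof.
move=> KL cK; apply: compact_closed; first exact: boundary_hausdorff.
apply: continuous_compact => //; apply/subspace_continuousP => x Kx W.
move=> /nbhs_boundaryP[//|r rW].
apply: filterS (postal_near r (KL x Kx)) => y yP Ky.
by apply: rW; apply: yP; apply: KL.
Qed.

Lemma postal_surjective (A : set M) : non_elementary G -> A `<=` Lam -> A !=set0 ->
  compact A -> invariant_set rho A -> post @` A = setT.
Proof.
move=> nonel AL [x Ax] cA invA; apply/seteqP; split=> // zeta _.
have [x' [Ax' ne]] : exists x', A x' /\ post x <> post x'.
  apply: contrapT => no; apply: nonel.
  apply: (boundary_fixed_point_elementary hypS (xi := post x)) => g.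
  rewrite -postal_equivariant; last exact: AL.
  apply: contrapT => ne; apply: no; exists (rho g x); split; first exact: invA.
  by move=> E; apply: ne.
apply: (postal_image_closed AL cA) => W /(nbhs_boundaryP hypS)[r rW].
have [g [sh|sh]] := boundary_orbit_dense hypS zeta r ne.
  exists (boundary_act g (post x)); split; last exact: rW.
  by exists (rho g x); [exact: invA | rewrite postal_equivariant //; exact: AL].
exists (boundary_act g (post x')); split; last exact: rW.
by exists (rho g x'); [exact: invA | rewrite postal_equivariant //; exact: AL].
Qed.

End PostalMap.

(** * Minimal sets *)

(** A finite Baire argument: either U lies inside the first closed set, or removing that set leaves
    a non-empty open set covered by the others. *)
Lemma finite_closed_cover_interior (T : topologicalType) (I : eqType) (l : seq I)
    (F : I -> set T) (U : set T) :
  (forall i, closed (F i)) -> open U -> U !=set0 ->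
  (forall x, U x -> exists2 i, i \in l & F i x) -> exists i, (F i)° !=set0.
Proof.
move=> clF; elim: l U => [|i l IH] U oU [x Ux] cov; first by have [] := cov x Ux.
case: (pselect (U `<=` F i)) => [sub|/existsNP[y /not_implyP[Uy nFy]]].
  by exists i, x; apply: filterS sub _; apply: open_nbhs_nbhs.
apply: (IH (U `&` ~` F i)).
- by apply: openI => //; apply: closed_openC.
- by exists y.
- move=> z [Uz nFz]; have [j] := cov z Uz.
  by rewrite inE => /orP[/eqP -> //|jl Fz]; exists j.
Qed.

Section MinimalSets.
Variables (R : realType) (G : groupType) (M : metricType R) (rho : G -> M -> M).
Hypothesis act : LHomeo_action rho.

(** The points of A whose orbit avoids O form a closed invariant set; if non-empty, it would be all
    of A, yet it misses x0. *)
Lemma minimal_orbit_meets (A O : set M) x0 : minimal_set rho A -> open O ->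
  A x0 -> O x0 -> forall a, A a -> exists g, O (rho g a).
Proof.
move=> [_ clA invA minA] oO Ax0 Ox0 a Aa; apply: contrapT => no.
pose B := A `&` \bigcap_g (rho g @^-1` (~` O)).
have BA : B = A.
  apply: minA; [| | |by move=> x []].
  - by exists a; split=> // g _ /= Oga; apply: no; exists g.
  - apply: closedI => //; apply: closed_bigI => g _.
    apply: closed_comp; first by move=> x _; apply: action_continuous.
    exact: open_closedC.
  - move=> g x [Ax Bx]; split; first exact: invA.
    by move=> h _ /=; have [_ _ rhoM] := act; rewrite -rhoM; apply: Bx.
have : B x0 by rewrite BA.
by move=> [_ /(_ 1%g I)] /=; have [_ rho1 _] := act; rewrite rho1.
Qed.

Lemma compact_finite_translates (A O : set M) : compact A -> open O ->
  (forall a, A a -> exists g, O (rho g a)) ->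
  exists l : seq G, forall a, A a -> exists2 g, g \in l & O (rho g a).
Proof.
move=> /compact_near_coveringP cA oO meets.
(* Finite lists directed by inclusion: near-covering compactness along this filter merges the local
   choices of g into one list. *)
pose F : set_system (seq G) := [set P | exists l0 : seq G, forall l,
  {subset l0 <= l} -> P l].
have filF : Filter F.
  split; first by exists [::].
    move=> P Q [l1 l1P] [l2 l2P]; exists (l1 ++ l2) => l sub.
    split; [apply: l1P|apply: l2P] => g gl; apply: sub; rewrite mem_cat gl ?orbT //.
  by move=> P Q PQ [l0 l0P]; exists l0 => l /l0P /PQ.
have [] := cA _ F (fun l a => exists2 g, g \in l & O (rho g a)) filF.
  move=> x /meets[g Og]; exists (rho g @^-1` O, [set l | g \in l]).
    split; first by apply: action_continuous => //; apply: open_nbhs_nbhs.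
    by exists [:: g] => l; apply; rewrite inE eqxx.
  by move=> [y l] [/= Oy gl]; exists g.
by move=> l0 l0P; exists l0; apply: l0P.
Qed.

End MinimalSets.

Theorem theorem1p4 (R : realType) (G : groupType) (S : set G)
    (M : metricType R) (rho : G -> M -> M) (Lam : set M)
    (D0 D : datum R G M) (N : nat) :
  hyperbolic_group S -> non_elementary G ->
  proper_space M -> geodesic_space M ->
  LHomeo_action rho ->
  Lam !=set0 -> compact Lam -> invariant_set rho Lam ->
  (forall x, Lam x -> ~ isolated [set: M] x) ->
  meandering_hyperbolic rho Lam D0 D N ->
  exists pi : Lam -> gromov_boundary S,
    [/\ is_postal_map rho D0 pi,
        equivariant rho pi,
        continuous pi,
        range pi = [set: gromov_boundary S] &
        forall (A : set M) (AL : A `<=` Lam), minimal_set rho A ->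
          quasi_open (pi \o set_incl AL)].
Proof.
move=> hypS nonel _ _ act Lam0 cLam inv noniso meander.
have [post postP] := postal_exists hypS act inv noniso meander Lam0.
have equi := postal_equivariant hypS act inv noniso meander postP.
have surj := postal_surjective hypS act inv noniso meander postP nonel.
exists (fun x : Lam => post (set_val x)); split.
- move=> x; split; last exact: (postP _ (set_valP x)).
  exact: (Ray_exists act inv meander (set_valP x)).
- by move=> g x y ->; apply: equi; apply: set_valP.
- move=> x W /(nbhs_boundaryP hypS)[r rW].
  have near := postal_near hypS act inv noniso meander postP r (set_valP x).
  have near' : \forall y \near x, Lam (set_val y) ->
      boundary_shadow (post (set_val x)) r (post (set_val y)).
    exact: (@initial_continuous Lam M set_val x _ near).
  by apply: filterS near' => y yP; apply: rW; apply: yP; apply: set_valP.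
- apply/seteqP; split=> // zeta _.
  have : (post @` Lam) zeta by rewrite surj.
  move=> [x Lx <-]; exists (SigSub (mem_set Lx)) => //.
move=> A AL minA W [V oV <-] [x0 Vx0].
have [_ clA invA _] := minA.
have cA : compact A by exact: subclosed_compact clA cLam AL.
have Ax0 : A (set_val x0) := set_valP x0.
have [e e0 eV] : exists2 e : R, 0 < e & ball (set_val x0) e `<=` V.
  by apply/nbhs_ballP; apply: open_nbhs_nbhs.
(* Half the radius leaves room for [closure O] to stay inside V. *)
pose O := (ball (set_val x0) (e / 2))°.
have oO : open O by exact: open_interior.
have Ox0 : O (set_val x0) by apply: nbhsx_ballx; rewrite divr_gt0.
pose K := A `&` closure O.
have KV : K `<=` A `&` V.
  move=> y [Ay clOy]; split=> //; apply: eV.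
  have e2 : 0 < e / 2 by rewrite divr_gt0.
  have [z [/interior_subset xz yz]] := clOy _ (nbhsx_ballx y _ e2).
  by have := ball_triangle xz (ball_sym yz); rewrite -splitr.
have cK : compact K.
  apply: subclosed_compact cA _; last by move=> y [].
  by apply: closedI; last exact: closed_closure.
have clK := postal_image_closed hypS act inv noniso meander postP
  (subset_trans (subIset (or_introl (@subset_refl _ A))) AL) cK.
have meets := minimal_orbit_meets act minA oO Ax0 Ox0.
have [l lP] := compact_finite_translates act cA oO meets.
(* By equivariance, [post a] lies in the set attached to g as soon as [rho g a] lies in O; so
   finitely many of these closed sets cover the boundary. *)
have clF g : closed ((boundary_act g : gromov_boundary S -> _) @^-1` (post @` K)).
  by apply: closed_comp => // x _; apply: boundary_act_continuous.
have [||g [xi xiP]] := finite_closed_cover_interior (l := l) clF openT.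
- by exists (post (set_val x0)).
- move=> zeta _; have : (post @` A) zeta by rewrite surj //; exists (set_val x0).
  move=> [a Aa <-]; have [g gl Og] := lP a Aa; exists g => //=.
  exists (rho g a); last by apply: equi; apply: AL.
  by split; [exact: invA | exact: subset_closure].
(* [xi] is interior to the preimage under g of the image of K; pulling back along the continuous
   action of g^-1 makes its translate interior to that image. *)
exists (boundary_act g xi).
have : nbhs (boundary_act g xi) (boundary_act g^-1%g @^-1`
    ((boundary_act g : gromov_boundary S -> _) @^-1` (post @` K))).
  by apply: boundary_act_continuous => //; rewrite boundary_actK.
apply: filterS => zeta /=.
rewrite -boundary_actM // mulgV boundary_act1 // => -[y /KV[Ay Vy] <-].
by exists (SigSub (mem_set Ay)).
Qed.
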